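(* Let $B>0$, let $A_B$ be such that $\mathbf{E}_\infty N_{A_B}=B$ (where $N_{A_B}$ is the Shiryaev-Roberts stopping time), and let $\nu$ be the time of the change. Let $N_{A_B}^{(1)},N_{A_B}^{(2)},\dots$ be sequential independent repetitions of $N_{A_B}$ (the procedure being restarted from scratch after each alarm, as defined in the context), let $Q_j=N_{A_B}^{(1)}+\cdots+N_{A_B}^{(j)}$ for $j\ge1$, and let $J_\nu=\min\{j\ge 1:Q_j\ge\nu\}$. (i) $\lim_{\nu\to\infty}\mathbf{E}_\nu(Q_{J_\nu}-\nu)$ exists. (ii) Suppose a detection procedure (stopping time) $N$ with $\mathbf{E}_\infty N=B$ is applied repeatedly. Let $N_1,N_2,\dots$ be sequential repetitions of $N$, let $W_j=\sum_{i=1}^j N_i$, and let $K_\nu=\min\{j:W_j\ge\nu\}$. Then, for every $B>0$, $$\lim_{\nu\to\infty}\mathbf{E}_\nu(Q_{J_\nu}-\nu)\le\lim_{\nu\to\infty}\mathbf{E}_\nu(W_{K_\nu}-\nu).\qquad( * )$$ (iii) Inequality $( * )$ holds for all $N\in\boldsymbol{\Delta}_B$, where $\boldsymbol{\Delta}_B=\{N:\mathbf{E}_\infty N\ge B\}$ (with $W_j$ and $K_\nu$ defined from sequential repetitions of $N$ as in (ii)).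
   Context: Changepoint setting: $X_1,X_2,\dots$ are independent observations, and $\nu$ denotes the serial number of the first post-change observation. For $1\le k<\infty$, $\mathbf{P}_k$ and $\mathbf{E}_k$ denote probability and expectation when $\nu=k$: $X_1,\dots,X_{k-1}$ each have density $f_0$ and $X_k,X_{k+1},\dots$ each have density $f_1$, all independent. $\mathbf{P}_\infty$ and $\mathbf{E}_\infty$ correspond to $\nu=\infty$ (no change): all $X_i$ are iid with density $f_0$. The densities $f_0$ and $f_1$ (with respect to a common reference measure) are known. A detection procedure is identified with a stopping time $N$ on $X_1,X_2,\dots$, i.e. $\{N\le n\}\in\mathcal{F}_n$, where $\mathcal{F}_n=\sigma(X_1,\dots,X_n)$. The average run length to false alarm of $N$ is $\mathrm{ARL2FA}(N)=\mathbf{E}_\infty N$. The Shiryaev-Roberts stopping time is $N_{A_B}=\min\{n\ge1:R_n\ge A_B\}$ with $R_n=\sum_{k=1}^n\prod_{i=k}^n\frac{f_1(X_i)}{f_0(X_i)}$. Sequential repetitions of $N_{A_B}$: set $N_{A_B}^{(0)}=0$ and, for $i\ge1$, $$N_{A_B}^{(i)}=\min\Big\{n>\sum_{j=1}^{i-1}N_{A_B}^{(j)}:R_n^{(i)}\ge A_B\Big\}-\sum_{j=1}^{i-1}N_{A_B}^{(j)},$$ where, for $n>\sum_{j=1}^{i-1}N_{A_B}^{(j)}$, $$R_n^{(i)}=\sum_{k=1+\sum_{j=1}^{i-1}N_{A_B}^{(j)}}^{n}\ \prod_{l=k}^n\frac{f_1(X_l)}{f_0(X_l)}.$$ That is, $R_n^{(i)}$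 is the Shiryaev-Roberts statistic renewed from scratch after the $(i-1)$st alarm and applied to the data $X_{1+\sum_{j=1}^{i-1}N_{A_B}^{(j)}},X_{2+\sum_{j=1}^{i-1}N_{A_B}^{(j)}},\dots$. Thus $Q_j$ is the time of the $j$-th alarm, and $Q_{J_\nu}$ is the time of the first alarm at or after $\nu$. Likewise, sequential repetitions $N_1,N_2,\dots$ of a general stopping time $N$ are obtained by applying the rule $N$ from scratch to the data following the previous alarm: $N_i$ is the value of $N$ computed on the sequence $X_{W_{i-1}+1},X_{W_{i-1}+2},\dots$, with $W_0=0$.
   Formalization: Assumes N_{A_B} is not P_∞-a.s. a constant m ≥ 2 (else the limit in (i) fails, e.g. f_0 = f_1, A_B = 2). The right limit in ( * ) is shown to exist for N with finite mean and span 1; for other N (e.g. N = B ≥ 2, which oscillates), ( * ) is claimed whenever it exists. *)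

(* Defs.v *)
From HB Require Import structures.
From mathcomp Require Import all_boot all_order all_algebra.
From mathcomp Require Import all_classical all_reals all_analysis.

Set Implicit Arguments.
Unset Strict Implicit.
Unset Printing Implicit Defensive.

Import Order.TTheory GRing.Theory Num.Theory.
Import numFieldNormedType.Exports.

Local Open Scope classical_set_scope.
Local Open Scope ring_scope.

(* A data sequence is x : nat -> T, where x i is the (i+1)-st observation.    *)
(* Times are in option nat, with None standing for +oo.                       *)

(* The minimum of {n | Q n}, or +oo if that set is empty. *)
Definition first_time (Q : nat -> Prop) : option nat :=
  if pselect (exists n, `[< Q n >]) is left e then Some (ex_minn e) else None.

Definition etime (R : realType) (t : option nat) : \bar R :=
  if t is Some n then (n%:R)%:E else +oo%E.

Definition time_le (t : option nat) (n : nat) : Prop :=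
  if t is Some m then (m <= n)%N else False.

Definition time_ge (t : option nat) (n : nat) : Prop :=
  if t is Some m then (n <= m)%N else True.

Definition shift_data (T : Type) (k : nat) (x : nat -> T) : nat -> T :=
  fun i => x (k + i)%N.

Section Model.
Context (R : realType) (d dO : measure_display).
Context (T : measurableType d) (Omega : measurableType dO).

Definition is_density (mu : {measure set T -> \bar R}) (f : T -> R) : Prop :=
  [/\ measurable_fun setT f, forall x, 0 <= f x
    & (\int[mu]_x (f x)%:E = 1)%E].

Definition mutually_independent (P : probability Omega R)
    (X : nat -> Omega -> T) : Prop :=
  forall (s : seq nat) (E : nat -> set T), uniq s ->
    (forall i, measurable (E i)) ->
    P (\big[setI/setT]_(i <- s) (X i @^-1` E i)) =
      (\prod_(i <- s) P (X i @^-1` E i))%E.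

Definition independent_with_densities (P : probability Omega R)
    (X : nat -> Omega -> T) (mu : {measure set T -> \bar R})
    (g : nat -> T -> R) : Prop :=
  mutually_independent P X /\
  forall i (E : set T), measurable E ->
    P (X i @^-1` E) = (\int[mu]_(x in E) (g i x)%:E)%E.

(* Density of the (i+1)-st observation when nu is the serial number of the
   first post-change observation. *)
Definition change_density (f0 f1 : T -> R) (nu i : nat) : T -> R :=
  if (i.+1 < nu)%N then f0 else f1.

(* Pinf is the no-change law.  The value P 0 is irrelevant. *)
Definition changepoint_model (mu : {measure set T -> \bar R})
    (f0 f1 : T -> R) (X : nat -> Omega -> T)
    (Pinf : probability Omega R) (P : nat -> probability Omega R) : Prop :=
  [/\ is_density mu f0, is_density mu f1, forall i, measurable_fun setT (X i),
      independent_with_densities Pinf X mu (fun=> f0)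
    & forall nu, (0 < nu)%N ->
        independent_with_densities (P nu) X mu (change_density f0 f1 nu)].

(* A detection procedure is a rule N on data sequences; {N <= n} belongs to the
   sigma-algebra generated by the first n observations, which is trivial for
   n = 0. *)
Definition stopping_time (N : (nat -> T) -> option nat) : Prop :=
  forall n, g_sigma_preimage (fun (i : 'I_n) (x : nat -> T) => x i)
              [set x | time_le (N x) n].

(* Division in \bar R satisfies a / 0 = +oo for a > 0 and 0 / 0 = 0. *)
Definition likelihood_ratio (f0 f1 : T -> R) (y : T) : \bar R :=
  ((f1 y)%:E / (f0 y)%:E)%E.

Definition sr_stat (f0 f1 : T -> R) (x : nat -> T) (n : nat) : \bar R :=
  (\sum_(0 <= k < n) \prod_(k <= i < n) likelihood_ratio f0 f1 (x i))%E.

Definition sr_time (f0 f1 : T -> R) (A : R) (x : nat -> T) : option nat :=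
  first_time (fun n => (1 <= n)%N /\ (A%:E <= sr_stat f0 f1 x n)%E).

(* Time of the j-th alarm when the rule N is restarted from scratch after each
   alarm; +oo as soon as one of the first j repetitions never stops. *)
Fixpoint alarm_time (N : (nat -> T) -> option nat) (x : nat -> T) (j : nat)
    : option nat :=
  if j is j'.+1 then
    if alarm_time N x j' is Some w then
      if N (shift_data w x) is Some m then Some (w + m)%N else None
    else None
  else Some 0%N.

Definition first_alarm_index (N : (nat -> T) -> option nat) (x : nat -> T)
    (nu : nat) : option nat :=
  first_time (fun j => (1 <= j)%N /\ time_ge (alarm_time N x j) nu).

(* The default None is never used for nu >= 1 when N >= 1: then the j-th alarm
   time is at least j. *)
Definition first_alarm_from (N : (nat -> T) -> option nat) (x : nat -> T)
    (nu : nat) : option nat :=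
  if first_alarm_index N x nu is Some j then alarm_time N x j else None.

Definition mean_time (P : probability Omega R) (X : nat -> Omega -> T)
    (N : (nat -> T) -> option nat) : \bar R :=
  (\int[P]_w etime R (N (X ^~ w)))%E.

Definition mean_delay (P : nat -> probability Omega R) (X : nat -> Omega -> T)
    (N : (nat -> T) -> option nat) (nu : nat) : \bar R :=
  (\int[P nu]_w (etime R (first_alarm_from N (X ^~ w) nu) - (nu%:R)%:E))%E.

(* When N is finite and positive almost surely: its distribution is not
   concentrated on the multiples of any k >= 2. *)
Definition aperiodic (P : probability Omega R) (X : nat -> Omega -> T)
    (N : (nat -> T) -> option nat) : Prop :=
  forall k, (forall n, (0 < P [set w | N (X ^~ w) = Some n])%E -> (k %| n)%N) ->
    k = 1%N.

End Model.

(* Main.v *)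
Require Import Defs.
From HB Require Import structures.
From mathcomp Require Import all_boot all_order all_algebra.
From mathcomp Require Import all_classical all_reals all_analysis.
From mathcomp Require Import measurable_realfun ring lra zify.

Set Implicit Arguments.
Unset Strict Implicit.
Unset Printing Implicit Defensive.

Import Order.TTheory GRing.Theory Num.Theory.
Import numFieldNormedType.Exports.
Local Open Scope classical_set_scope.
Local Open Scope ring_scope.

(** Throughout, a rule is restarted after each of its alarms, and the change
    comes after t observations, that is, nu = t.+1.

    Renewal structure. Before the change the alarms of a rule N form a renewal
    process with interarrival law that of N under no change. Decomposing at
    the first alarm and solving the resulting renewal equation gives
    delay t = \sum_(s <= t) u s * D (t - s), where u s is the probability of an
    alarm at s and D k is the expected delay of a single cycle when the change
    comes k observations after the start of the cycle (renewal_equation,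
    renewal_equation_solution). If N has finite mean and is aperiodic, u s
    tends to 1 / E N by the renewal theorem, so the delay tends to
    (\sum_k D k) / E N (delay_cvg).

    From delays to an area. A change of measure turns \sum_k D k into
    \sum_n E [R n; N > n], where R n is the Shiryaev-Roberts statistic and E
    is the expectation under no change; in general the former is at least the
    latter, with equality for the Shiryaev-Roberts rule (sr_area_change,
    sr_total_delay). It remains to compare rules by the ratio of this area to
    the mean of N.

    Optimal stopping. For a price c, consider the problem of minimizing
    \sum_(n < N) (R n - c) in mean. Given the threshold A, let c be the ratio of
    expected area to expected length for a run of the chain R that starts
    at A. A coupling of chains with different starting points shows that
    with this price it is best to stop precisely when R reaches A
    (threshold_verification). With w 0 denoting minus the optimal value, every
    rule satisfies area >= c * E N - w 0, with equality for the
    Shiryaev-Roberts rule, whose limiting delay is therefore c - w 0 / B,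
    whereas area / E N >= c - w 0 / E N >= c - w 0 / B for any rule with
    E N >= B, because w 0 >= 0.

    Rules with infinite mean or periodic alarms. There the delay need not
    converge, but if it does, then its limit is the limit of its averages over
    change points. The lower bound on the area holds for truncated cycles, and
    the average over cycles needs only an upper bound on the expected number
    of alarms (delay_limit_ge).

    Finally, the Shiryaev-Roberts rule is aperiodic unless its alarm time is a
    constant greater than 1, by a zero-one law (sr_tail_prob_decreasing), so
    its delay converges. *)

(** * The space of data sequences *)

Section PathSpace.
Context (d : measure_display) (T : measurableType d).

Definition box (n : nat) (A : nat -> set T) : set (nat -> T) :=
  [set x | forall i, (i < n)%N -> A i (x i)].

Definition boxes : set (set (nat -> T)) :=
  [set E | exists n A, (forall i, measurable (A i)) /\ E = box n A].

(** The sigma-algebra is generated by boxes rather than by single coordinates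
    because boxes are closed under intersection, so that a law on data sequences
    is determined by its values on them. *)
Definition dataseq := g_sigma_algebraType boxes.

Lemma boxes_setI : setI_closed boxes.
Proof.
move=> _ _ [n [A [mA ->]]] [m [B [mB ->]]].
pose pad k (C : nat -> set T) i := if (i < k)%N then C i else setT.
exists (maxn n m), (fun i => pad n A i `&` pad m B i); split.
  by move=> i; rewrite /pad; apply: measurableI; case: ifP.
apply/seteqP; split => x /=.
  by move=> [xA xB] i _; split; rewrite /pad; case: ifP => // /[dup] *; [exact: xA|exact: xB].
move=> xAB; split=> i ik.
  by have := (xAB i (leq_trans ik (leq_maxl _ _))).1; rewrite /pad ik.
by have := (xAB i (leq_trans ik (leq_maxr _ _))).2; rewrite /pad ik.
Qed.

Lemma box_measurable n A : (forall i, measurable (A i)) ->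
  @measurable _ dataseq (box n A).
Proof. by move=> mA; apply: sub_sigma_algebra; exists n, A. Qed.

Lemma measurable_coord i : measurable_fun [set: dataseq] (fun x : dataseq => x i).
Proof.
move=> _ A mA; rewrite setTI.
pose C j := if j == i then A else setT.
rewrite (_ : _ @^-1` A = box i.+1 C); last first.
  apply/seteqP; split => x /=; first by move=> xA j _; rewrite /C; case: eqP => // ->.
  by move=> /(_ i (ltnSn i)); rewrite /C eqxx.
by apply: box_measurable => j; rewrite /C; case: ifP.
Qed.

Lemma measurable_to_dataseq d' (U : measurableType d') (f : U -> dataseq) :
  (forall i, measurable_fun setT (fun u => f u i)) -> measurable_fun setT f.
Proof.
move=> mf; apply: (@measurability _ _ U dataseq setT f boxes) => //.
move=> _ [_ [n [A [mA ->]]] <-].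
rewrite setTI (_ : f @^-1` box n A =
    \bigcap_(i in [set i | (i < n)%N]) ((fun u => f u i) @^-1` A i)); last first.
  by apply/seteqP; split => u /= uA i /=; apply: uA.
apply: fin_bigcap_measurable; last first.
  by move=> i _; rewrite -[X in measurable X]setTI; exact: mf.
exact: finite_II.
Qed.

(** Independence of the first n observations from the later ones is expressed
    throughout as invariance of integrals under glueing a fresh sequence after
    time n. *)
Definition glue (n : nat) (x y : nat -> T) : nat -> T :=
  fun i => if (i < n)%N then x i else y (i - n)%N.

Lemma measurable_glue n :
  measurable_fun setT (fun z : dataseq * dataseq => glue n z.1 z.2 : dataseq).
Proof.
apply: measurable_to_dataseq => i; rewrite /glue; case: (i < n)%N.
  by apply: (measurableT_comp (measurable_coord i)); exact: (@measurable_fst _ _ dataseq dataseq).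
by apply: (measurableT_comp (measurable_coord (i - n)%N)); exact: (@measurable_snd _ _ dataseq dataseq).
Qed.

Lemma measurable_shift n :
  measurable_fun setT (fun x : dataseq => shift_data n x : dataseq).
Proof. by apply: measurable_to_dataseq => i; exact: measurable_coord. Qed.

Context (R : realType).

Definition product_law (m : probability dataseq R) (q : nat -> set T -> \bar R) :=
  forall n A, (forall i, measurable (A i)) ->
    m (box n A) = (\prod_(i < n) q i (A i))%E.

(** Both sides are integrals against laws of data sequences which agree on
    boxes, hence everywhere; Fubini's theorem then separates the two pieces. *)
Lemma integral_glue (m m1 m2 : probability dataseq R)
    (q q1 q2 : nat -> set T -> \bar R) (n : nat) :
  product_law m q -> product_law m1 q1 -> product_law m2 q2 ->
  (forall i, (i < n)%N -> q i = q1 i) -> (forall j, q (n + j)%N = q2 j) ->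
  forall H : dataseq -> \bar R, measurable_fun [set: dataseq] H -> (forall x, 0 <= H x)%E ->
  (\int[m]_x H x = \int[m1]_x \int[m2]_y H (glue n x y))%E.
Proof.
move=> mq mq1 mq2 qq1 qq2 H mH H0.
have mg := @measurable_glue n.
pose g (z : dataseq * dataseq) : dataseq := glue n z.1 z.2.
have E A : measurable A -> m A = pushforward (m1 \x m2)%E g A.
  apply: (@measure_unique _ _ dataseq boxes (fun=> setT)) => //.
  - exact: boxes_setI.
  - by move=> i; exists 0%N, (fun=> setT); split => //; apply/seteqP; split.
  - by rewrite bigcup_const//; exists 0%N.
  - move=> _ [k [B [mB ->]]].
    apply: (etrans (mq k B mB)).
    transitivity ((m1 \x m2)%E (g @^-1` box k B)); last by [].
    rewrite (_ : g @^-1` _ = box (minn k n) B `*` box (k - n) (fun j => B (n + j)%N) :> set (dataseq * dataseq)); last first.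
      apply/seteqP; split => -[x y] /=.
        move=> xy; split => i /=; rewrite ?leq_min.
          move=> /andP[ik in_]; have := xy i ik; by rewrite /g /glue /= in_.
        rewrite ltn_subRL => ik; have := xy _ ik.
        by rewrite /g /glue /= ltnNge leq_addr /= addKn.
      move=> [xB yB] i ik; rewrite /g /glue /=; case: ltnP => ni.
        by apply: xB; rewrite leq_min ik.
      have := yB (i - n)%N; rewrite subnKC//; apply.
      by rewrite ltn_sub2r// (leq_ltn_trans ni).
    rewrite product_measure1E; [|exact: box_measurable|exact: box_measurable].
    suff : (\prod_(i < k) q i (B i) = m1 (box (minn k n) B) *
        m2 (box (k - n) (fun j => B (n + j)%N)))%E by [].
    rewrite mq1// mq2//.
    case: (leqP k n) => kn.
      rewrite (eqP kn : (k - n = 0)%N) big_ord0 mule1.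
      by apply: eq_bigr => i _; rewrite qq1// (leq_trans (ltn_ord i)).
    transitivity (\prod_(i < n + (k - n)) q i (B i))%E; first by rewrite subnKC// ltnW.
    rewrite big_split_ord /=; congr (_ * _)%E.
      by apply: eq_bigr => i _; rewrite qq1.
    by apply: eq_bigr => i _; rewrite qq2.
  - by move=> k; rewrite (le_lt_trans (probability_le1 _ _))// ltry.
rewrite (eq_measure_integral (pushforward (m1 \x m2)%E g)); last first.
  by move=> A mA _; exact: E.
rewrite ge0_integral_pushforward// preimage_setT fubini_tonelli1//=.
exact: measurableT_comp mH mg.
Qed.

End PathSpace.

(** * Laws of the data and change of measure *)

Section Laws.
Context (d : measure_display) (T : measurableType d) (R : realType).
Notation dataseq := (dataseq T).
Local Open Scope ereal_scope.

(** Together with measurability this is the form in which adaptedness is used: a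
    function of the first n observations does not see what is glued after them. *)
Definition prefix_determined (U : Type) (n : nat) (F : dataseq -> U) :=
  forall x y : nat -> T, (forall i, (i < n)%N -> x i = y i) -> F x = F y.

Lemma glue_prefix n (x y : nat -> T) i : (i < n)%N -> glue n x y i = x i.
Proof. by rewrite /glue => ->. Qed.

Lemma glue_suffix n (x y : nat -> T) : shift_data n (glue n x y) = y.
Proof.
by apply/funext => i; rewrite /shift_data /glue ltnNge leq_addr /= addKn.
Qed.

Lemma glue_determined U n (F : dataseq -> U) (x y : nat -> T) :
  prefix_determined n F -> F (glue n x y) = F x.
Proof. by apply=> i; exact: glue_prefix. Qed.

Lemma measurable_glue_right n (x : dataseq) :
  measurable_fun setT (fun y : dataseq => glue n x y : dataseq).
Proof.
apply: measurable_to_dataseq => i; rewrite /glue; case: (i < n)%N.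
  exact: measurable_cst.
exact: measurable_coord.
Qed.

Lemma integral_cst_prob d' (U : measurableType d') (m : probability U R) (c : \bar R) :
  \int[m]_x c = c.
Proof.
rewrite integral_cst//; have : m setT = 1 by exact: probability_setT.
by move=> mT; transitivity (c * m setT); [|rewrite mT mule1].
Qed.

Lemma integral_coord0 (m : probability dataseq R) (q : nat -> set T -> \bar R)
    (q0 : probability T R) (g : T -> \bar R) :
  product_law m q -> (forall A, measurable A -> q 0%N A = q0 A) ->
  measurable_fun setT g -> (forall t, 0 <= g t) ->
  \int[m]_x g (x 0%N) = \int[q0]_t g t.
Proof.
move=> mq qq0 mg g0.
have mc := @measurable_coord _ T 0.
rewrite [RHS](eq_measure_integral (pushforward m (fun x : dataseq => x 0%N))); last first.
  move=> A mA _; apply: (etrans (esym (qq0 A mA))).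
  have -> : q 0%N A = m (box 1 (fun=> A)) by rewrite mq// big_ord1.
  transitivity (m ((fun x : dataseq => x 0%N) @^-1` A)); last by [].
  congr (m _); apply/seteqP; split => x /=; first by apply.
  by move=> xA [|].
by rewrite ge0_integral_pushforward// preimage_setT.
Qed.

(** The function lr acts as a density of q1 with respect to q0, although q1 need
    not be absolutely continuous: off G, where the likelihood ratio is infinite,
    q1 may have mass that q0 does not see. This is why only an inequality holds
    unless g vanishes off G. *)
Definition density_ratio (q0 q1 : probability T R) (lr : T -> R) (G : set T) : Prop :=
  forall g : T -> \bar R, measurable_fun setT g -> (forall t, 0 <= g t) ->
    \int[q0]_t (g t * (lr t)%:E) <= \int[q1]_t g t /\
    ((forall t, ~ G t -> g t = 0) ->
     \int[q0]_t (g t * (lr t)%:E) = \int[q1]_t g t).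

(** The observations of index i < j have law q0 under Lam j and the others have
    law q1, so Lam j describes a change whose first post-change observation has
    serial number j.+1. There is no change under Linf. *)
Variables (q0 q1 : probability T R) (Linf : probability dataseq R)
  (Lam : nat -> probability dataseq R).
Hypotheses (LinfE : product_law Linf (fun=> q0))
  (LamE : forall j, product_law (Lam j) (fun i => if (i < j)%N then q0 else q1 : set T -> \bar R)).

Lemma integral_Linf_glue n (H : dataseq -> \bar R) :
  measurable_fun setT H -> (forall x, 0 <= H x) ->
  \int[Linf]_x H x = \int[Linf]_x \int[Linf]_y H (glue n x y).
Proof. by move=> mH H0; exact: (integral_glue LinfE LinfE LinfE). Qed.

(** After j observations, a change that was j + k observations ahead is k
    observations ahead. *)
Lemma integral_Lam_glue j k (H : dataseq -> \bar R) :
  measurable_fun setT H -> (forall x, 0 <= H x) ->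
  \int[Lam (j + k)%N]_x H x = \int[Linf]_x \int[Lam k]_y H (glue j x y).
Proof.
move=> mH H0; apply: (integral_glue (LamE _) LinfE (LamE k)) => //.
  by move=> i ij; rewrite ltn_addr.
by move=> i; rewrite ltn_add2l.
Qed.

Lemma integral_Lam_prefix n (H : dataseq -> \bar R) :
  measurable_fun setT H -> (forall x, 0 <= H x) -> prefix_determined n H ->
  \int[Lam n]_x H x = \int[Linf]_x H x.
Proof.
move=> mH H0 dH; rewrite -{1}(addn0 n) integral_Lam_glue//.
apply: eq_integral => x _.
under eq_integral => y _ do rewrite (glue_determined _ _ dH).
exact: integral_cst_prob.
Qed.

(** The observation of index n has law q0 and is independent of the past. *)
Lemma integral_next_observation n (H : dataseq * T -> \bar R) :
  measurable_fun setT H -> (forall z, 0 <= H z) ->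
  (forall t, prefix_determined n (fun x => H (x, t))) ->
  \int[Linf]_x H (x, x n) = \int[Linf]_x \int[q0]_t H (x, t).
Proof.
move=> mH H0 dH; rewrite (@integral_Linf_glue n (fun x => H (x, x n)))//; last first.
  have mp : measurable_fun setT (fun x : dataseq => (x, x n)).
    by apply: measurable_fun_pair; [exact: measurable_id|exact: measurable_coord].
  exact: measurableT_comp mH mp.
apply: eq_integral => x _.
under eq_integral => y _.
  rewrite (glue_determined _ _ (dH _)) {1}/glue ltnn subnn; over.
rewrite (@integral_coord0 _ _ q0 (fun t => H (x, t)) LinfE)//.
exact: measurableT_comp mH (pair1_measurable x).
Qed.

Variables (lr : T -> R) (G : set T).
Hypotheses (mlr : measurable_fun setT lr) (lr_ge0 : forall t, (0 <= lr t)%R)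
  (lrE : density_ratio q0 q1 lr G).

Let first_slice (H : dataseq -> \bar R) (t : T) :=
  \int[Lam 0]_y H (glue 1 (fun=> t) y).

Let measurable_first_slice H : measurable_fun setT H -> (forall x, 0 <= H x) ->
  measurable_fun setT (first_slice H).
Proof.
move=> mH H0.
apply: (@measurable_fun_fubini_tonelli_F _ _ T dataseq _ (Lam 0)
  (fun z => H (glue 1 (fun=> z.1) z.2))) => //.
suff mgg : measurable_fun setT (fun z : T * dataseq => glue 1 (fun=> z.1) z.2 : dataseq).
  exact: measurableT_comp mH mgg.
apply: measurable_to_dataseq => i; rewrite /glue; case: (i < 1)%N.
  exact: (@measurable_fst _ _ T dataseq).
by apply: (measurableT_comp (measurable_coord (i - 1)%N)); exact: (@measurable_snd _ _ T dataseq).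
Qed.

Let first_law j (q : probability T R) (H : dataseq -> \bar R) (g : T -> R) :
  (j <= 1)%N -> (forall A, measurable A -> (if (0 < j)%N then q0 A else q1 A) = q A) ->
  measurable_fun setT H -> (forall x, 0 <= H x) ->
  measurable_fun setT g -> (forall t, (0 <= g t)%R) ->
  \int[Lam j]_x (H x * (g (x 0%N))%:E) = \int[q]_t (first_slice H t * (g t)%:E).
Proof.
move=> j1 qE mH H0 mg g0.
have mgE : measurable_fun setT (EFin \o g) by exact/measurable_EFinP.
have mHg : measurable_fun setT (fun x : dataseq => H x * (g (x 0%N))%:E).
  by apply: emeasurable_funM => //; exact: measurableT_comp mgE (measurable_coord 0).
rewrite (@integral_glue _ _ _ _ _ _ _ _ _ 1 (LamE j) (LamE j) (LamE 0))//; first last.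
- by move=> x; rewrite mule_ge0// lee_fin.
- by move=> i; rewrite add1n ltn0; case: j j1 {qE} => [|[]]// _; rewrite ltnS.
rewrite -(@integral_coord0 (Lam j) _ q (fun t => first_slice H t * (g t)%:E) (LamE j)); first last.
- by move=> t; rewrite mule_ge0 ?lee_fin//; apply: integral_ge0.
- by apply: emeasurable_funM => //; exact: measurable_first_slice.
- by move=> A mA; rewrite -qE//; case: ifP.
apply: eq_integral => x _; rewrite muleC -ge0_integralZl//; last 2 first.
- exact: measurableT_comp mH (measurable_glue_right 1 (fun=> x 0%N)).
- by rewrite lee_fin.
apply: eq_integral => y _.
have -> : glue 1 (fun=> x 0%N) y = glue 1 x y.
  by apply/funext => i; rewrite /glue; case: ltnP => //; case: i.
exact: muleC.
Qed.

(** Lam j.+1 and Lam j differ only in the law of the observation of index j.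
    Integrating out all the other observations leaves a function of that one, to
    which density_ratio applies. *)
Lemma change_one_observation j (H : dataseq -> \bar R) :
  measurable_fun setT H -> (forall x, 0 <= H x) ->
  \int[Lam j.+1]_x (H x * (lr (x j))%:E) <= \int[Lam j]_x H x /\
  ((forall x, ~ G (x j) -> H x = 0) ->
  \int[Lam j.+1]_x (H x * (lr (x j))%:E) = \int[Lam j]_x H x).
Proof.
move=> mH H0.
have mlrE : measurable_fun setT (EFin \o lr) by exact/measurable_EFinP.
have mHl : measurable_fun setT (fun x : dataseq => H x * (lr (x j))%:E).
  by apply: emeasurable_funM => //; exact: measurableT_comp mlrE (measurable_coord j).
have Hl0 x : 0 <= H x * (lr (x j))%:E by rewrite mule_ge0// lee_fin.
pose K (x y : dataseq) := H (glue j x y).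
have mK x : measurable_fun setT (K x).
  exact: measurableT_comp mH (measurable_glue_right j x).
have E1 : \int[Lam j.+1]_x (H x * (lr (x j))%:E) =
    \int[Linf]_x \int[q0]_t (first_slice (K x) t * (lr t)%:E).
  rewrite -addn1 integral_Lam_glue//; apply: eq_integral => x _.
  rewrite -(@first_law 1 q0)//; last by move=> y; exact: H0.
  by apply: eq_integral => y _; rewrite {2}/glue ltnn subnn.
have E0 : \int[Lam j]_x H x = \int[Linf]_x \int[q1]_t first_slice (K x) t.
  rewrite -{1}(addn0 j) integral_Lam_glue//; apply: eq_integral => x _.
  under [RHS]eq_integral => t _ do rewrite -[first_slice _ _]mule1.
  rewrite -(@first_law 0 q1 (K x) (fun=> 1%R))//; last by move=> y; exact: H0.
  by apply: eq_integral => y _; rewrite mule1.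
have s0 x t : 0 <= first_slice (K x) t by apply: integral_ge0 => y _; exact: H0.
have ms x : measurable_fun setT (first_slice (K x)).
  by apply: measurable_first_slice => // y; exact: H0.
have mf (q : probability T R) (g : T -> R) : measurable_fun setT g -> (forall t, 0 <= g t)%R ->
    measurable_fun setT (fun x => \int[q]_t (first_slice (K x) t * (g t)%:E)).
  move=> mg g0.
  have mgE : measurable_fun setT (EFin \o g) by exact/measurable_EFinP.
  apply: (@measurable_fun_fubini_tonelli_F _ _ dataseq T _ q
     (fun z => first_slice (K z.1) z.2 * (g z.2)%:E)); last first.
    by move=> z; rewrite mule_ge0// lee_fin.
  apply: emeasurable_funM; last first.
    exact: measurableT_comp mgE (@measurable_snd _ _ dataseq T).
  apply: (@measurable_fun_fubini_tonelli_F _ _ (dataseq * T)%type dataseq _ (Lam 0)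
     (fun z => K z.1.1 (glue 1 (fun=> z.1.2) z.2))); last by move=> z; exact: H0.
  suff mgg : measurable_fun setT (fun z : (dataseq * T) * dataseq =>
      glue j z.1.1 (glue 1 (fun=> z.1.2) z.2) : dataseq).
    exact: measurableT_comp mH mgg.
  apply: measurable_to_dataseq => i; rewrite /glue.
  have m1 := @measurable_fst _ _ (dataseq * T)%type dataseq.
  case: (i < j)%N.
    exact: (measurableT_comp (measurable_coord i)
      (measurableT_comp (@measurable_fst _ _ dataseq T) m1)).
  case: (i - j < 1)%N.
    exact: (measurableT_comp (@measurable_snd _ _ dataseq T) m1).
  exact: (measurableT_comp (measurable_coord (i - j - 1)%N)
    (@measurable_snd _ _ (dataseq * T)%type dataseq)).
rewrite E1 E0; split.
- apply: ge0_le_integral => //.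
  + by move=> x _; apply: integral_ge0 => t _; rewrite mule_ge0// lee_fin.
  + exact: mf.
  + rewrite (_ : (fun x => _) = fun x => \int[q1]_t (first_slice (K x) t * 1%:E)).
      exact: (mf q1 (fun=> 1%R) (measurable_cst _) (fun=> ler01)).
    by apply/funext => x; apply: eq_integral => t _; rewrite mule1.
  + by move=> x _; exact: (lrE (ms x) (s0 x)).1.
- move=> HG; apply: eq_integral => x _; apply: (lrE (ms x) (s0 x)).2 => t nG.
  rewrite /first_slice integral0_eq// => y _; apply: HG.
  by rewrite /glue ltnn subnn.
Qed.

Definition lr_prod (j n : nat) (x : dataseq) : R := (\prod_(j <= i < n) lr (x i))%R.

Lemma lr_prod_ge0 j n x : (0 <= lr_prod j n x)%R.
Proof. by apply: prodr_ge0. Qed.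

Lemma measurable_lr_prod j n : measurable_fun setT (lr_prod j n).
Proof.
apply: measurable_prod => i _; exact: measurableT_comp mlr (measurable_coord i).
Qed.

Lemma lr_prod_determined j n : prefix_determined n (lr_prod j n).
Proof.
move=> x y xy; rewrite /lr_prod big_nat_cond [RHS]big_nat_cond.
by apply: eq_bigr => i /andP[/andP[_ /xy ->]].
Qed.

Let change_observations j k (H : dataseq -> \bar R) :
  measurable_fun setT H -> (forall x, 0 <= H x) ->
  \int[Lam (j + k)%N]_x (H x * (lr_prod j (j + k) x)%:E) <= \int[Lam j]_x H x /\
  ((forall x i, (i < j + k)%N -> ~ G (x i) -> H x = 0) ->
   \int[Lam (j + k)%N]_x (H x * (lr_prod j (j + k) x)%:E) = \int[Lam j]_x H x).
Proof.
move=> mH H0; elim: k => [|k [I1 I2]].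
  rewrite addn0.
  by under eq_integral do rewrite /lr_prod big_geq// mule1.
pose K (x : dataseq) := H x * (lr_prod j (j + k) x)%:E.
have mK : measurable_fun setT K.
  by apply: emeasurable_funM => //; apply/measurable_EFinP; exact: measurable_lr_prod.
have K0 x : 0 <= K x by rewrite mule_ge0// lee_fin lr_prod_ge0.
have [C1 C2] := @change_one_observation (j + k) K mK K0.
have E : \int[Lam (j + k.+1)%N]_x (H x * (lr_prod j (j + k.+1) x)%:E) =
    \int[Lam (j + k).+1]_x (K x * (lr (x (j + k)%N))%:E).
  rewrite addnS; apply: eq_integral => x _.
  by rewrite /K -muleA -EFinM /lr_prod big_nat_recr ?leq_addr.
rewrite E; split; first exact: le_trans C1 I1.
move=> HG; rewrite C2 ?I2//; first by move=> x i ik; apply: HG; rewrite addnS ltnW.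
by move=> x nG; rewrite /K (HG x (j + k)%N) ?mul0e// addnS.
Qed.

(** The change is moved from n down to j by one observation at a time; a
    function of the first n observations does not distinguish a change at n from
    no change at all. *)
Lemma change_of_measure j n (H : dataseq -> \bar R) : (j <= n)%N ->
  measurable_fun setT H -> (forall x, 0 <= H x) -> prefix_determined n H ->
  \int[Linf]_x (H x * (lr_prod j n x)%:E) <= \int[Lam j]_x H x /\
  ((forall x i, (i < n)%N -> ~ G (x i) -> H x = 0) ->
   \int[Linf]_x (H x * (lr_prod j n x)%:E) = \int[Lam j]_x H x).
Proof.
move=> jn mH H0 dH.
rewrite -(@integral_Lam_prefix n (fun x => H x * (lr_prod j n x)%:E)); first last.
- by move=> x y xy; rewrite (dH x y xy) (lr_prod_determined _ xy).
- by move=> x; rewrite mule_ge0// lee_fin lr_prod_ge0.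
- by apply: emeasurable_funM => //; apply/measurable_EFinP; exact: measurable_lr_prod.
by have := @change_observations j (n - j)%N H mH H0; rewrite subnKC.
Qed.

End Laws.

(** * Integration against a density *)

Section Density.
Context (d : measure_display) (T : measurableType d) (R : realType).
Import HBNNSimple.
Local Open Scope ereal_scope.

(** As mu is an arbitrary measure, Radon-Nikodym derivatives are not at hand:
    simple functions are treated directly, and the rest follows by monotone
    convergence. *)
Lemma integral_density (mu q : {measure set T -> \bar R}) (f : T -> R) :
  measurable_fun setT f -> (forall x, 0 <= f x)%R ->
  (forall E, measurable E -> q E = \int[mu]_(x in E) (f x)%:E) ->
  forall g : T -> \bar R, measurable_fun setT g -> (forall x, 0 <= g x) ->
  \int[q]_x g x = \int[mu]_x (g x * (f x)%:E).
Proof.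
move=> mf f0 qE g mg g0.
have mfE : measurable_fun setT (EFin \o f) by exact/measurable_EFinP.
pose h := nnsfun_approx measurableT mg.
have hcvg x : (EFin \o h ^~ x) @ \oo --> g x by apply: cvg_nnsfun_approx.
have -> : \int[q]_x g x = lim (\int[q]_x (EFin \o h n) x @[n --> \oo]).
  under eq_integral => x _ do rewrite -(cvg_lim _ (hcvg x))//.
  apply: monotone_convergence => //.
  - by move=> n; exact/measurable_EFinP/measurable_funP.
  - by move=> n x _; rewrite lee_fin.
  - by move=> x _ a b ab; rewrite lee_fin; exact/lefP/nd_nnsfun_approx.
have -> : \int[mu]_x (g x * (f x)%:E) =
    lim (\int[mu]_x ((EFin \o h n) x * (f x)%:E) @[n --> \oo]).
  have gf x : (EFin \o h n) x * (f x)%:E @[n --> \oo] --> g x * (f x)%:E.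
    by apply: cvgeZr => //; exact: hcvg.
  under eq_integral => x _ do rewrite -(cvg_lim _ (gf x))//.
  apply: monotone_convergence => //.
  - move=> n; apply: emeasurable_funM; last exact: mfE.
    exact/measurable_EFinP/measurable_funP.
  - by move=> n x _ /=; rewrite mule_ge0 ?lee_fin.
  - move=> x _ a b ab; rewrite lee_wpmul2r ?lee_fin//.
    exact/lefP/nd_nnsfun_approx.
congr (lim (_ @ \oo)); apply/funext => n.
have mind r : measurable_fun setT
    (fun x => (r * \1_(h n @^-1` [set r]) x)%:E).
  by apply/measurable_EFinP; exact: measurable_funM.
rewrite [LHS]integralT_nnsfun sintegralE.
transitivity (\int[mu]_x (\sum_(r \in range (h n))
    ((r * \1_(h n @^-1` [set r]) x)%:E * (f x)%:E))); last first.
  apply: eq_integral => x _.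
  rewrite -ge0_mule_fsuml => [|y]; last exact: nnfun_muleindic_ge0.
  by rewrite fsumEFin // -(fimfunE _ x).
rewrite ge0_integral_fsum//; last 2 first.
  - by move=> r; apply: emeasurable_funM.
  - by move=> m y _; apply: mule_ge0; rewrite ?lee_fin//; exact: nnfun_muleindic_ge0.
apply: eq_fsbigr => r rh.
have r0 : (0 <= r)%R by move: rh; rewrite inE => -[x _ <-].
under [RHS]eq_integral => x _ do rewrite EFinM -muleA.
rewrite ge0_integralZl//; last 2 first.
  - by apply: emeasurable_funM => //; exact/measurable_EFinP.
  - by move=> x _; rewrite mule_ge0 ?lee_fin.
congr (_ * _); rewrite qE//.
rewrite integral_mkcond/=; apply: eq_integral => x _.
by rewrite patchE indicE; case: ifP => _; rewrite ?mul1e ?mul0e.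
Qed.

End Density.

(** * The renewal theorem *)

Section NumericalSemigroup.

(** The least positive difference e of two elements of D divides every n in D:
    otherwise n %% e would be a smaller difference, between n + (n %/ e) * x and
    (n %/ e) * (x + e) where x and x + e are in D. So e = 1, and two consecutive
    elements x and x + 1 generate every number from x * x on. *)
Lemma numerical_semigroup (D : nat -> Prop) :
  D 0%N -> (forall a b, D a -> D b -> D (a + b)%N) ->
  (forall k, (forall n, D n -> (k %| n)%N) -> k = 1%N) ->
  exists a, forall n, (a <= n)%N -> D n.
Proof.
move=> D0 DD Dgcd.
have DM a q : D a -> D (q * a)%N.
  by move=> Da; elim: q => [|q IH]; rewrite ?mul0n// mulSn; exact: DD.
pose P e := (0 < e)%N && `[< exists x, D x /\ D (x + e)%N >].
have exP : exists e, P e.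
  apply: contrapT => nP; suff : 2%N = 1%N by [].
  apply: Dgcd => n Dn; have [->//|n_gt0] := posnP n.
  by case: nP; exists n; rewrite /P n_gt0; apply/asboolP; exists 0%N.
have [e /andP[e_gt0 /asboolP[x [Dx Dxe]]] emin] := ex_minnP exP.
have e1 : e = 1%N.
  apply: Dgcd => n Dn; rewrite /dvdn; apply/negPn/negP; rewrite -lt0n => r_gt0.
  suff /emin : P (n %% e)%N by rewrite leqNgt ltn_mod e_gt0.
  rewrite /P r_gt0; apply/asboolP; exists (n %/ e * (x + e))%N; split; first exact: DM.
  rewrite (_ : _ + _ = n + n %/ e * x)%N; first by apply: DD => //; exact: DM.
  by rewrite {3}(divn_eq n e) mulnDr; lia.
rewrite {}e1 in Dxe.
exists (x * x)%N => n xn; have [x0|x_gt0] := posnP x.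
  by rewrite x0 add0n in Dxe; rewrite -(muln1 n); exact: DM.
rewrite (_ : n = (n %/ x - n %% x) * x + (n %% x) * (x + 1))%N.
  by apply: DD; exact: DM.
have rx : (n %% x < x)%N by rewrite ltn_mod.
have qx : (x <= n %/ x)%N by rewrite leq_divRL.
by rewrite {1}(divn_eq n x) mulnDr muln1 addnA -mulnDl subnK// ltnW// (leq_trans rx).
Qed.

End NumericalSemigroup.

Section Renewal.
Context (R : realType).
(** p n is the probability that an interarrival time exceeds n, so p i - p i.+1
    is the probability that it equals i.+1, and u n is the probability of a
    renewal at time n. *)
Variables (p u : nat -> R).
Hypotheses (p0 : p 0%N = 1) (p_ge0 : forall n, 0 <= p n)
  (p_noninc : forall n, p n.+1 <= p n).
Hypotheses (u0 : u 0%N = 1)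
  (uS : forall n, u n.+1 = \sum_(i < n.+1) (p i - p i.+1) * u (n - i)%N).

(** The summand of index i is the probability that the last renewal up to time n
    happens at n - i. *)
Lemma renewal_cover n : \sum_(i < n.+1) p i * u (n - i)%N = 1.
Proof.
elim: n => [|n IH]; first by rewrite big_ord_recl big_ord0 p0 u0 mulr1 addr0.
rewrite big_ord_recl p0 mul1r subn0 uS -[RHS]IH -big_split /=.
by apply: eq_bigr => i _; rewrite /bump add1n subSS mulrBl subrK.
Qed.

Lemma renewal_ge0 n : 0 <= u n.
Proof.
elim/ltn_ind: n => -[|n] IH; first by rewrite u0.
rewrite uS; apply: sumr_ge0 => i _; rewrite mulr_ge0 ?subr_ge0//.
by apply: IH; rewrite ltnS leq_subr.
Qed.

Lemma renewal_le1 n : u n <= 1.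
Proof.
rewrite -(renewal_cover n) big_ord_recl p0 mul1r subn0 lerDl.
by apply: sumr_ge0 => i _; rewrite mulr_ge0// renewal_ge0.
Qed.

Lemma tail_noninc m n : (m <= n)%N -> p n <= p m.
Proof.
move=> mn; rewrite -(subnK mn); elim: (n - m)%N => // k IH.
by rewrite addSn (le_trans (p_noninc _)).
Qed.

Hypothesis p_to0 : p @ \oo --> 0.

Lemma sum_mass m : \sum_(i < m) (p i - p i.+1) = 1 - p m.
Proof.
elim: m => [|m IH]; first by rewrite big_ord0 p0 subrr.
by rewrite big_ord_recr /= IH; lra.
Qed.

Lemma sum_mass_from I m :
  \sum_(i < m) (if (I <= i)%N then p i - p i.+1 else 0) = p I - p (maxn I m).
Proof.
elim: m => [|m IH]; first by rewrite big_ord0 maxn0 subrr.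
rewrite big_ord_recr /= IH; case: leqP => Im.
  by rewrite (maxn_idPr (leqW Im)); lra.
by rewrite (maxn_idPl Im) addr0.
Qed.

Section LimSup.
Variables (y : nat -> R) (lam : R).
Hypotheses (y_le1 : forall n, `|y n| <= 1) (lam_le1 : `|lam| <= 1)
  (yS : forall n, y n.+1 = \sum_(i < n.+1) (p i - p i.+1) * y (n - i)%N).
Hypotheses
  (ytop : forall e : R, 0 < e -> exists N, forall n, (N <= n)%N -> y n <= lam + e)
  (yfreq : forall (e : R) N, 0 < e -> exists2 n, (N <= n)%N & lam - e <= y n).

(** Wherever y is nearly as large as its upper limit lam, it was nearly as large
    k steps earlier. Speaking of all such indices n avoids extracting a
    subsequence along which y converges to lam. *)
Definition near_top (k : nat) := forall e : R, 0 < e -> exists (del : R) N, 0 < del /\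
  forall n, (N <= n)%N -> lam - del <= y n -> lam - e <= y (n - k)%N.

Lemma near_topD a b : near_top a -> near_top b -> near_top (a + b)%N.
Proof.
move=> ta tb e e0; have [del [N [del0 HN]]] := tb e e0.
have [del' [N' [del'0 HN']]] := ta del del0.
exists del', (N' + N + a)%N; split=> // n nN yn; rewrite subnDA; apply: HN.
  by lia.
by apply: HN' => //; lia.
Qed.

(** y n.+1 is an average of earlier values of y, and almost all the weight sits
    on values that are at most lam up to a small error. If the average is close
    to lam, then so is every value that carries a fixed positive weight. *)
Lemma near_top_support k : p k.+1 < p k -> near_top k.+1.
Proof.
move=> pk e e0; pose f := p k - p k.+1.
have f0 : 0 < f by rewrite subr_gt0.
have fe0 : 0 < f * e by rewrite mulr_gt0.
pose e' := f * e / 8; have e'0 : 0 < e' by rewrite divr_gt0.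
have [N0 HN0] := ytop e'0.
have [I [pI kI]] : exists I, p I <= e' /\ (k < I)%N.
  have /cvgrPdist_le/(_ e' e'0)[I0 _ HI] := p_to0; exists (maxn I0 k.+1).
  rewrite leq_maxr; split=> //; have := HI _ (leq_maxl I0 k.+1).
  by rewrite sub0r normrN; exact: le_trans (ler_norm _).
exists (f * e / 4), (N0 + I + 1)%N; split; first by rewrite divr_gt0.
move=> [|n]; first by rewrite addn1.
rewrite addn1 ltnS => nN yn.
have nI : (I <= n)%N := leq_trans (leq_addl _ _) nN.
have natI i : (i < I)%N -> (N0 <= n - i)%N by clear -nN; lia.
rewrite leNgt; apply/negP => yk; move: yn; apply/negP; rewrite -ltNge.
rewrite subSS in yk.
have [lamN lamP] : -1 <= lam /\ lam <= 1 by move: lam_le1; rewrite ler_norml => /andP[].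
have yB m : y m <= 1 by apply: le_trans (y_le1 m); exact: ler_norm.
(* The missing weight 1 - \sum_(i < n.+1) (p i - p i.+1) is p n.+1, which
   is small. *)
have -> : y n.+1 = \sum_(i < n.+1) (p i - p i.+1) * (y (n - i)%N - (lam + e'))
    + (1 - p n.+1) * (lam + e').
  rewrite yS -sum_mass mulr_suml -big_split /=; apply: eq_bigr => i _.
  by rewrite mulrBr subrK.
have kn : (k < n.+1)%N by rewrite ltnS (leq_trans (ltnW kI)).
(* The term k is at most - f * e, the other terms below I are nonpositive,
   and the factors from I on, which are at most 2, have total weight at
   most p I. *)
have : \sum_(i < n.+1) (p i - p i.+1) * (y (n - i)%N - (lam + e')) <=
    \sum_(i < n.+1) ((if i == Ordinal kn then - (f * e) else 0) +
      (if (I <= i)%N then p i - p i.+1 else 0) * 2).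
  apply: ler_sum => i _.
  have mi : 0 <= p i - p i.+1 by rewrite subr_ge0.
  case: eqP => [->|_] /=.
    rewrite ifF ?mul0r ?addr0; last by apply/negbTE; rewrite -ltnNge.
    by rewrite -mulrN ler_wpM2l ?(ltW f0)//; lra.
  rewrite add0r; case: leqP => Ii.
    by rewrite ler_wpM2l//; have := yB (n - i)%N; lra.
  by rewrite mul0r mulr_ge0_le0// subr_le0; exact/HN0/natI.
rewrite big_split /= -big_mkcond big_pred1_eq -mulr_suml sum_mass_from.
rewrite (maxn_idPr (leqW nI)).
have := p_ge0 n.+1.
have : p n.+1 <= p I by apply: tail_noninc; exact: leqW.
have : p n.+1 * -1 <= p n.+1 * (lam + e') by rewrite ler_wpM2l//; lra.
rewrite /e' in pI e'0 *; lra.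
Qed.

Hypothesis aper : forall k, (forall n, p n.+1 < p n -> (k %| n.+1)%N) -> k = 1%N.
Variables (mu s : R).
Hypothesis sum_p : (fun n => \sum_(i < n) p i) @ \oo --> mu.
Hypothesis ycover : forall n, \sum_(i < n.+1) p i * y (n - i)%N = s.

Lemma partial_sum_le n : \sum_(i < n) p i <= mu.
Proof.
have nd : nondecreasing_seq (fun n => \sum_(i < n) p i).
  by apply/nondecreasing_seqP => k; rewrite big_ord_recr /= lerDl.
have := nondecreasing_cvgn_le nd (cvgP _ sum_p) n.
by rewrite (cvg_lim _ sum_p).
Qed.

(** By aperiodicity, y is close to lam on a window of any prescribed length that
    ends a bounded number a0 of steps before an index where it is nearly
    maximal. On such a window the identity ycover reads lam * mu = s up to a
    small error. *)
Lemma top_value : lam * mu = s.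
Proof.
have [a0 Ha0] : exists a, forall n, (a <= n)%N -> near_top n.
  apply: numerical_semigroup.
  - by move=> e e0; exists e, 0%N; split => // n _; rewrite subn0.
  - exact: near_topD.
  - by move=> k Hk; apply: aper => n /near_top_support; exact: Hk.
have [lamN lamP] : -1 <= lam /\ lam <= 1 by move: lam_le1; rewrite ler_norml => /andP[].
have mu0 : 0 <= mu by have := partial_sum_le 0; rewrite big_ord0.
suff H (e : R) : 0 < e -> `|s - lam * mu| <= (mu + 3) * e.
  apply/esym/eqP; rewrite -subr_eq0 -normr_le0; apply/ler_addgt0Pr => e e0.
  rewrite add0r; have := H (e / (mu + 3)); rewrite divr_gt0//; last by lra.
  by move=> /(_ isT)/le_trans; apply; rewrite mulrC divfK// gt_eqF//; lra.
move=> e0.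
have [I HI] : exists I, mu - e <= \sum_(i < I) p i.
  have /cvgrPdist_le/(_ e e0)[I _ HI] := sum_p; exists I.
  by have := HI I (leqnn _); rewrite ler_norml => /andP[_]; lra.
have [del [N [del0 HN]]] : exists del N, 0 < del /\ forall k, (k < I)%N ->
    forall n, (N <= n)%N -> lam - del <= y n -> lam - e <= y (n - (a0 + k))%N.
  elim: (I) => [|J [del [N [del0 HN]]]]; first by exists 1, 0%N.
  have [del' [N' [del'0 HN']]] := Ha0 (a0 + J)%N (leq_addr _ _) e e0.
  exists (Num.min del del'), (maxn N N'); split; first by rewrite lt_min del0.
  move=> k; rewrite ltnS leq_eqVlt => /predU1P[->|kJ] n; rewrite geq_max => /andP[nN nN'] yn.
    by apply: HN' => //; apply: le_trans yn; rewrite lerD2l lerN2 ge_min lexx orbT.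
  by apply: HN => //; apply: le_trans yn; rewrite lerD2l lerN2 ge_min lexx.
have [N1 HN1] := ytop e0.
have [n nN yn] := yfreq (N + N1 + a0 + I)%N del0.
pose m := (n - a0)%N.
have Im : (I <= m.+1)%N by rewrite /m; lia.
have E : s - lam * \sum_(i < m.+1) p i = \sum_(i < m.+1) p i * (y (m - i)%N - lam).
  rewrite -(ycover m) mulr_sumr -sumrB; apply: eq_bigr => i _.
  by rewrite mulrBr (mulrC lam).
have bnd : `|s - lam * \sum_(i < m.+1) p i| <= mu * e + 2 * e.
  rewrite E (le_trans (ler_norm_sum _ _ _))//.
  have : \sum_(i < m.+1) `|p i * (y (m - i)%N - lam)| <=
     \sum_(i < m.+1) (p i * e + (if (I <= i)%N then p i else 0) * 2).
    apply: ler_sum => i _; rewrite normrM ger0_norm//; case: leqP => iI.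
      rewrite -mulrDr ler_wpM2l// (le_trans (ler_normB _ _))//.
      by have := y_le1 (m - i)%N; move: lam_le1 e0; lra.
    rewrite mul0r addr0 ler_wpM2l// ler_norml.
    have -> : (m - i = n - (a0 + i))%N by rewrite /m; lia.
    have := HN i iI n; have := HN1 (n - (a0 + i))%N.
    have -> : (N1 <= n - (a0 + i))%N by lia.
    have -> : (N <= n)%N by lia.
    by move=> /(_ isT) ? /(_ isT yn) ?; apply/andP; split; lra.
  move=> /le_trans; apply; rewrite big_split /= -!mulr_suml.
  have S1 := partial_sum_le m.+1.
  have S2 : \sum_(i < m.+1) (if (I <= i)%N then p i else 0) <= e.
    have : \sum_(i < m.+1) p i = \sum_(i < I) p i +
        \sum_(i < m.+1) (if (I <= i)%N then p i else 0).
      rewrite -(subnKC Im) !big_split_ord /= [X in _ = _ + (X + _)]big1 ?add0r.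
        by congr +%R; apply: eq_bigr => i _; rewrite leq_addr.
      by move=> i _; rewrite leqNgt ltn_ord.
    lra.
  by rewrite lerD ?ler_wpM2r ?(ltW e0)// mulrC ler_wpM2l.
have S1 := partial_sum_le m.+1.
have S3 : mu - e <= \sum_(i < m.+1) p i.
  apply: le_trans HI _; rewrite -(subnKC Im) big_split_ord /= lerDl.
  by apply: sumr_ge0.
have -> : s - lam * mu = (s - lam * \sum_(i < m.+1) p i) +
    lam * (\sum_(i < m.+1) p i - mu) by lra.
rewrite (le_trans (ler_normD _ _))// normrM.
have : `|lam| * `|\sum_(i < m.+1) p i - mu| <= 1 * e.
  by rewrite ler_pM// ler_norml; apply/andP; split; lra.
lra.
Qed.

End LimSup.

Lemma limsup_exists (y : nat -> R) : (forall n, `|y n| <= 1) ->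
  exists lam, [/\ `|lam| <= 1,
    (forall e : R, 0 < e -> exists N, forall n, (N <= n)%N -> y n <= lam + e) &
    (forall (e : R) N, 0 < e -> exists2 n, (N <= n)%N & lam - e <= y n)].
Proof.
move=> y1; pose E := [set z | exists N, forall n, (N <= n)%N -> y n <= z].
have E1 : E 1 by exists 0%N => n _; apply: le_trans (y1 n); exact: ler_norm.
have El : lbound E (-1).
  move=> z [N /(_ N (leqnn _))]; apply: le_trans.
  by have := y1 N; rewrite ler_norml => /andP[].
have Einf : has_inf E by split; [exists 1|exists (-1)].
exists (inf E); split.
- rewrite ler_norml; apply/andP; split; first by apply: lb_le_inf => //; exists 1.
  by apply: ge_inf => //; exists (-1).
- move=> e e0; have [z [N HN] ze] := inf_adherent e0 Einf.
  by exists N => n nN; rewrite (le_trans (HN n nN))// ltW.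
- move=> e N e0; apply: contrapT => H.
  suff : inf E <= inf E - e by lra.
  apply: ge_inf; first by exists (-1).
  exists N => n nN; rewrite leNgt; apply/negP => yn; apply: H.
  by exists n => //; exact: ltW.
Qed.

(** The theorem of Erdos, Feller and Pollard for a finite mean: applied to u and
    to - u, top_value identifies the upper limit and the lower limit of u. *)
Theorem renewal_theorem (mu : R) :
  (forall k, (forall n, p n.+1 < p n -> (k %| n.+1)%N) -> k = 1%N) ->
  (fun n => \sum_(i < n) p i) @ \oo --> mu -> u @ \oo --> mu^-1.
Proof.
move=> aper sum_p.
have u1 n : `|u n| <= 1 by rewrite ger0_norm ?renewal_ge0// renewal_le1.
have [l1 [l1b top1 fr1]] := limsup_exists u1.
have [l2 [l2b top2 fr2]] : exists lam, [/\ `|lam| <= 1,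
    (forall e : R, 0 < e -> exists N, forall n, (N <= n)%N -> - u n <= lam + e) &
    (forall (e : R) N, 0 < e -> exists2 n, (N <= n)%N & lam - e <= - u n)].
  by apply: limsup_exists => n; rewrite normrN.
have e1 : l1 * mu = 1.
  by apply: (top_value u1 l1b uS top1 fr1 aper sum_p); exact: renewal_cover.
have e2 : l2 * mu = - 1.
  apply: (@top_value (fun n => - u n) _ _ l2b _ top2 fr2 aper _ _ sum_p).
  - by move=> n; rewrite normrN.
  - by move=> n; rewrite uS -sumrN; apply: eq_bigr => i _; rewrite mulrN.
  - by move=> n; rewrite -(renewal_cover n) -sumrN; apply: eq_bigr => i _; rewrite mulrN.
have mu_neq0 : mu != 0 by apply/eqP => mu0; move: e1; rewrite mu0; lra.
have -> : mu^-1 = l1 by rewrite -[LHS]mul1r -e1 mulfK.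
have l21 : l2 = - l1.
  by apply: (mulIf mu_neq0); rewrite e2 mulNr e1.
apply/cvgrPdist_le => e e0.
have [N1 H1] := top1 _ e0; have [N2 H2] := top2 _ e0.
exists (maxn N1 N2) => // n /=; rewrite geq_max => /andP[n1 n2].
have := H1 n n1; have := H2 n n2; rewrite l21 ler_norml => ? ?.
by apply/andP; split; lra.
Qed.

End Renewal.

(** * Convolution with a convergent sequence *)

Section Convolution.
Context (R : realType).
Local Open Scope ereal_scope.

Lemma sum_rev_ord (V : nmodType) (F : nat -> nat -> V) n :
  (\sum_(s < n.+1) F s (n - s)%N = \sum_(k < n.+1) F (n - k)%N k)%R.
Proof.
rewrite (reindex_inj rev_ord_inj) /=; apply: eq_bigr => i _.
by rewrite subSS subKn// -ltnS.
Qed.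

(** Tannery's theorem: the terms from K on are controlled by the tail of the
    series of d, the first K terms by the convergence of u. *)
Lemma cvg_convolution_real (u d : nat -> R) (l S : R) :
  (0 <= l)%R -> (forall n, (0 <= u n <= 1)%R) -> u @ \oo --> l ->
  (forall k, (0 <= d k)%R) -> (fun n => \sum_(k < n) d k)%R @ \oo --> S ->
  (fun n => \sum_(k < n.+1) u (n - k)%N * d k)%R @ \oo --> (l * S)%R.
Proof.
move=> l0 u01 ul d0 dS.
have dSle n : (\sum_(k < n) d k <= S)%R.
  have nd : nondecreasing_seq (fun n => \sum_(i < n) d i)%R.
    by apply/nondecreasing_seqP => k; rewrite big_ord_recr /= lerDl.
  have := nondecreasing_cvgn_le nd (cvgP _ dS) n.
  by rewrite (cvg_lim _ dS).
have S0 : (0 <= S)%R by have := dSle 0%N; rewrite big_ord0.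
apply/cvgrPdist_le => e e0; pose C := (S + 1 + l + l)%R.
have C0 : (0 < C)%R by rewrite /C; lra.
pose e' := (e / C)%R; have e'0 : (0 < e')%R by rewrite divr_gt0.
have /cvgrPdist_le/(_ e' e'0)[N _ HN] := ul.
have /cvgrPdist_le/(_ e' e'0)[K _ HK] := dS.
exists (N + K)%N => // n /= nNK.
have Kn : (K <= n.+1)%N by lia.
have HKK : (S - e' <= \sum_(k < K) d k)%R.
  by have := HK K (leqnn _); rewrite ler_norml => /andP[_]; lra.
have HKn : (S - e' <= \sum_(k < n.+1) d k)%R.
  by have := HK n.+1 Kn; rewrite ler_norml => /andP[_]; lra.
have -> : (l * S - \sum_(k < n.+1) u (n - k)%N * d k =
    l * (S - \sum_(k < n.+1) d k) + \sum_(k < n.+1) (l - u (n - k)%N) * d k)%R.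
  have -> : (\sum_(k < n.+1) (l - u (n - k)%N) * d k =
      l * (\sum_(k < n.+1) d k) - \sum_(k < n.+1) u (n - k)%N * d k)%R.
    by rewrite mulr_sumr -sumrB; apply: eq_bigr => i _; rewrite mulrBl.
  lra.
rewrite (le_trans (ler_normD _ _))//.
have b1 : (`|l * (S - \sum_(k < n.+1) d k)| <= l * e')%R.
  rewrite normrM ger0_norm// ler_wpM2l// ler_norml; apply/andP; split.
    by have := dSle n.+1; lra.
  lra.
have b2 : (`|\sum_(k < n.+1) (l - u (n - k)%N) * d k| <= S * e' + (1 + l) * e')%R.
  rewrite (le_trans (ler_norm_sum _ _ _))//.
  have : (\sum_(k < n.+1) `|(l - u (n - k)%N) * d k| <=
     \sum_(k < n.+1) (d k * e' + (1 + l) * (if (K <= k)%N then d k else 0)))%R.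
    apply: ler_sum => k _; rewrite normrM (ger0_norm (d0 _)); case: leqP => kK.
      have := u01 (n - k)%N => /andP[ua ub].
      have : (`|l - u (n - k)%N| <= 1 + l)%R by rewrite ler_norml; apply/andP; split; lra.
      move=> /(ler_wpM2r (d0 k)).
      by have := mulr_ge0 (d0 k) (ltW e'0); lra.
    rewrite mulr0 addr0 mulrC ler_wpM2l//; apply: HN => /=; lia.
  move=> /le_trans; apply; rewrite big_split /= -mulr_suml -mulr_sumr.
  apply: lerD; first by rewrite ler_wpM2r ?(ltW e'0)//; exact: dSle.
  rewrite ler_wpM2l//; first lra.
  have : (\sum_(i < n.+1) d i = \sum_(i < K) d i +
        \sum_(i < n.+1) (if (K <= i)%N then d i else 0))%R.
    rewrite -(subnKC Kn) !big_split_ord /= [X in _ = (_ + (X + _))%R]big1 ?add0r.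
      by congr +%R; apply: eq_bigr => i _; rewrite leq_addr.
    by move=> i _; rewrite leqNgt ltn_ord.
  by have := dSle n.+1; lra.
have -> : e = ((S + 1 + l + l) * e')%R by rewrite /e' mulrC divfK// gt_eqF.
lra.
Qed.

(** If the series of D diverges, a long initial block of terms on which u is at
    least l / 2 is already large. *)
Lemma cvg_convolution (u : nat -> R) (D : nat -> \bar R) (l : R) :
  (0 < l)%R -> (forall n, (0 <= u n <= 1)%R) -> u @ \oo --> l ->
  (forall k, 0 <= D k) ->
  (fun n => \sum_(s < n.+1) (u s)%:E * D (n - s)%N) @ \oo -->
    l%:E * \sum_(k <oo) D k.
Proof.
move=> l0 u01 ul D0.
rewrite (_ : (fun n => _) = fun n => \sum_(k < n.+1) (u (n - k)%N)%:E * D k); last first.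
  by apply/funext => n; rewrite (sum_rev_ord (fun s t => (u s)%:E * D t)).
have cD : (fun n => \sum_(k < n) D k) @ \oo --> \sum_(k <oo) D k.
  have := @is_cvg_nneseries R D xpredT 0%N (fun n _ _ => D0 n).
  by under eq_fun do rewrite big_mkord.
have S0 : 0 <= \sum_(k <oo) D k by apply: nneseries_ge0.
have [Soo|Sfin] := eqVneq (\sum_(k <oo) D k) +oo.
  rewrite Soo gt0_muley ?lte_fin//; rewrite Soo in cD.
  apply/cvgeyPge => A.
  have /cvgeyPge/(_ (2 * `|A| / l)%R)[K _ HK] := cD.
  have l20 : (0 < l / 2)%R by rewrite divr_gt0.
  have /cvgrPdist_le/(_ _ l20)[N _ HN] := ul.
  exists (N + K)%N => // n /= nNK.
  have Kn : (K <= n.+1)%N by lia.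
  have term_ge0 k : 0 <= (u (n - k)%N)%:E * D k.
    by rewrite mule_ge0// lee_fin; have /andP[] := u01 (n - k)%N.
  have : A%:E <= (l / 2)%:E * \sum_(k < K) D k.
    have := HK K (leqnn _) => /(@lee_wpmul2l _ (l / 2)%:E).
    rewrite lee_fin (ltW l20) => /(_ isT); apply: le_trans.
    rewrite -EFinM lee_fin (_ : (l / 2 * (2 * `|A| / l) = `|A|)%R) ?ler_norm//.
    by field; rewrite ?pnatr_eq0 ?gt_eqF.
  move=> /le_trans; apply; rewrite ge0_sume_distrr; last by move=> i _.
  rewrite -(subnKC Kn) big_split_ord /=.
  apply: (@le_trans _ _ (\sum_(i < K) (u (n - i)%N)%:E * D i)).
    apply: lee_sum => i _; apply: lee_wpmul2r => //; rewrite lee_fin.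
    have /= := HN (n - i)%N; have -> : (N <= n - i)%N by have := ltn_ord i; lia.
    by move=> /(_ isT); rewrite ler_norml => /andP[_]; lra.
  by rewrite leeDl//; apply: sume_ge0 => i _; exact: term_ge0.
have Sf : \sum_(k <oo) D k \is a fin_num.
  by rewrite ge0_fin_numE// lt_neqAle Sfin leey.
have Df k : D k \is a fin_num.
  rewrite ge0_fin_numE//; apply: le_lt_trans (_ : \sum_(k <oo) D k < +oo); last first.
    by rewrite lt_neqAle Sfin leey.
  have := @nneseries_lim_ge R D xpredT 0%N k.+1 (fun n _ _ => D0 n); rewrite big_mkord.
  by apply: le_trans; rewrite big_ord_recr /= leeDr// sume_ge0.
pose dd k := fine (D k).
have DE k : D k = (dd k)%:E by rewrite fineK.
rewrite -(fineK Sf) -EFinM.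
rewrite (_ : (fun n => _) = EFin \o (fun n => \sum_(k < n.+1) u (n - k)%N * dd k)%R); last first.
  apply/funext => n /=; rewrite -sumEFin; apply: eq_bigr => i _.
  by rewrite DE.
apply: cvg_EFin; first by near=> n.
apply: cvg_convolution_real => //; first exact: ltW.
  by move=> k; rewrite fine_ge0.
move: cD; rewrite -{1}(fineK Sf) => /fine_cvgP[_].
apply: cvg_trans; apply: near_eq_cvg; near=> n => /=.
by under eq_bigr do rewrite DE; rewrite sumEFin.
Unshelve. all: by end_near. Qed.

End Convolution.

(** * Averages of renewal convolutions *)

Section RenewalBound.

(** Both sides sum F s k over the pairs with N <= s + k < M. *)
Lemma sum_diagonals (V : nmodType) (F : nat -> nat -> V) (N M : nat) :
  (\sum_(N <= t < M) \sum_(s < t.+1) F s (t - s)%N =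
   \sum_(s < M) \sum_((N - s)%N <= k < (M - s)%N) F s k)%R.
Proof.
transitivity (\sum_(N <= t < M) \sum_(0 <= s < M | (s <= t)%N) F s (t - s)%N)%R.
  rewrite big_nat_cond [RHS]big_nat_cond; apply: eq_bigr => t /andP[/andP[_ tM] _].
  rewrite -(big_mkord xpredT (fun s => F s (t - s)%N)) (big_nat_widen _ _ M)//.
rewrite (exchange_big_dep xpredT)//= big_mkord; apply: eq_bigr => s _.
have E : (N <= N - s + s)%N by lia.
transitivity (\sum_((N - s + s)%N <= t < M) F s (t - s)%N)%R.
  rewrite [RHS](big_nat_widenl _ N)// big_nat_cond [RHS]big_nat_cond.
  by apply: eq_bigl => t /=; lia.
rewrite big_addn; apply: eq_bigr => k _; by rewrite addnK.
Qed.

Context (R : realType).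
Variables (p u : nat -> R) (D : nat -> \bar R) (B c w : R).
Hypotheses (p0 : p 0%N = 1) (p_ge0 : forall n, 0 <= p n)
  (p_noninc : forall n, p n.+1 <= p n).
Hypotheses (u0 : u 0%N = 1)
  (uS : forall n, u n.+1 = \sum_(i < n.+1) (p i - p i.+1) * u (n - i)%N).
Hypotheses (B_gt0 : 0 < B) (c_ge0 : 0 <= c) (w_ge0 : 0 <= w)
  (D_ge0 : forall k, (0 <= D k)%E)
  (DB : forall a m, (a <= m)%N ->
    ((c * \sum_(a <= n < m) p n)%:E <= \sum_(a <= k < m) D k + w%:E)%E)
  (pB : forall b, b < B -> exists m, b <= \sum_(n < m) p n).

Let cover n : \sum_(s < n.+1) u s * p (n - s)%N = 1.
Proof.
rewrite -(renewal_cover p0 u0 uS n) (reindex_inj rev_ord_inj) /=.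
apply: eq_bigr => i _; rewrite subSS subKn 1?mulrC//.
by rewrite -ltnS.
Qed.

Let u_ge0 := renewal_ge0 p_noninc u0 uS.

(** A renewal before M opens a cycle of which at most m time units are counted,
    on average \sum_(n < m) p n of them; all the counted units are distinct and
    lie before M + m. *)
Lemma renewal_count_le M m :
  (\sum_(s < M) u s) * \sum_(n < m) p n <= (M + m)%:R.
Proof.
have -> : (M + m)%:R = \sum_(0 <= t < M + m) \sum_(s < t.+1) u s * p (t - s)%N :> R.
  under eq_bigr do rewrite cover.
  by rewrite sumr_const_nat subn0.
rewrite (sum_diagonals (fun s k => u s * p k)) mulr_suml.
rewrite big_split_ord /= -[leLHS]addr0; apply: lerD; last first.
  by apply: sumr_ge0 => s _; apply: sumr_ge0 => k _; rewrite mulr_ge0.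
apply: ler_sum => s _; rewrite sub0n -mulr_sumr ler_wpM2l//.
have sm : (m <= M + m - s)%N by have := ltn_ord s; lia.
rewrite [leRHS](big_cat_nat _ sm)//= -(big_mkord xpredT p) lerDl.
by apply: sumr_ge0.
Qed.

(** The bound DB charges at least c for every time unit of a cycle, up to the
    constant w, and the cycles cover each time unit of [N, M) exactly once by
    renewal_cover. A cycle that began before N is charged from N on only, so
    that delays for changes before N, which may be infinite, do not enter. *)
Lemma sum_delay_ge N M : (N <= M)%N ->
  ((c * (M - N)%:R - w * \sum_(s < M) u s)%:E <=
    \sum_(N <= t < M) \sum_(s < t.+1) (u s)%:E * D (t - s)%N)%E.
Proof.
move=> NM; rewrite (sum_diagonals (fun s k => (u s)%:E * D k)%E).
have -> : (M - N)%:R = \sum_(N <= t < M) \sum_(s < t.+1) u s * p (t - s)%N :> R.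
  under eq_bigr do rewrite cover.
  by rewrite sumr_const_nat.
rewrite (sum_diagonals (fun s k => u s * p k)) !mulr_sumr -sumrB -sumEFin.
apply: lee_sum => s _; rewrite -ge0_sume_distrr; last by move=> k _.
rewrite -mulr_sumr mulrCA (mulrC w) -mulrBr EFinM lee_wpmul2l ?lee_fin//.
by rewrite EFinB leeBlDr// DB//; lia.
Qed.

(** A limit equals the limit of averages, and averages require nothing of u
    beyond the count of renewals. This covers periodic rules as well as rules
    with infinite mean. *)
Lemma delay_limit_ge (l : \bar R) :
  (fun t => \sum_(s < t.+1) (u s)%:E * D (t - s)%N)%E @ \oo --> l ->
  ((c - w / B)%:E <= l)%E.
Proof.
set del := (fun t => _) => dl.
have del0 t : (0 <= del t)%E.
  by apply: sume_ge0 => s _; rewrite mule_ge0// lee_fin.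
have l0 : (0 <= l)%E.
  rewrite -(cvg_lim _ dl)//; apply: lime_ge; first by apply: cvgP dl.
  by apply: nearW.
case: l dl l0 => [l| |] dl l0; [|by rewrite leey|by []].
rewrite lee_fin; apply/ler_addgt0Pr => e e0.
have H b : 0 < b -> b < B -> c - w / b <= l + e.
  move=> b0 bB; have [m bm] := pB bB.
  have [N HN] : exists N, forall t, (N <= t)%N -> (del t <= (l + e)%:E)%E.
    have /fine_cvgP[[N1 _ HN1] /cvgrPdist_le/(_ e e0)[N2 _ HN2]] := dl.
    exists (maxn N1 N2) => t; rewrite geq_max => /andP[t1 t2].
    rewrite -(fineK (HN1 t t1)) lee_fin.
    by have := HN2 t t2; rewrite ler_norml /= => /andP[]; lra.
  pose Q := w / b.
  have Q0 : 0 <= Q by rewrite divr_ge0// ltW.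
  have H1 M : (N <= M)%N -> c * (M - N)%:R - Q * (M + m)%:R <= (l + e) * (M - N)%:R.
    move=> NM; rewrite -lee_fin; have := sum_delay_ge NM.
    have : (\sum_(N <= t < M) del t <= ((l + e) * (M - N)%:R)%:E)%E.
      rewrite mulr_natr -sumr_const_nat -sumEFin big_nat_cond [leRHS]big_nat_cond.
      by apply: lee_sum => t /andP[/andP[? _] _]; exact: HN.
    move=> h1 h2; apply: le_trans h1; apply: le_trans h2.
    rewrite lee_fin lerD2l lerN2.
    have u1 : (\sum_(s < M) u s) * b <= (M + m)%:R.
      apply: le_trans (renewal_count_le M m); rewrite ler_wpM2l//.
      by apply: sumr_ge0.
    rewrite (_ : Q * _ = w * ((M + m)%:R / b)); last by rewrite /Q; ring.
    by rewrite ler_wpM2l// ler_pdivlMr.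
  rewrite leNgt; apply/negP => lt; pose x := c - Q - (l + e).
  have x0 : 0 < x by rewrite subr_gt0.
  have [k Hk] : exists k : nat, Q * (N + m)%:R < x * k%:R.
    exists (Num.truncn (Q * (N + m)%:R / x)).+1; rewrite [ltRHS]mulrC -ltr_pdivrMr//.
    exact: truncnS_gt.
  have := H1 (N + k)%N (leq_addr _ _); rewrite addKn.
  rewrite (_ : (N + k + m)%:R = (N + m)%:R + k%:R :> R); last first.
    by rewrite addnAC natrD.
  by move: Hk; rewrite /x; lra.
rewrite leNgt; apply/negP => lt.
pose x := c - l - e.
have x0 : w / B < x by rewrite /x; lra.
have xgt0 : 0 < x by apply: le_lt_trans x0; rewrite divr_ge0// ltW.
(* Any b strictly between w / x and B contradicts H. *)
pose b := (w / x + B) / 2.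
have wxB : w / x < B by rewrite ltr_pdivrMr// mulrC -ltr_pdivrMr.
have wx0 : 0 <= w / x by rewrite divr_ge0// ltW.
have b0 : 0 < b by rewrite /b; lra.
have bB : b < B by rewrite /b; lra.
have := H b b0 bB.
have : w / b < x by rewrite ltr_pdivrMr// mulrC -ltr_pdivrMr//; rewrite /b; lra.
by rewrite /x; lra.
Qed.

End RenewalBound.

(** * The optimal stopping problem behind a threshold rule *)

Section Threshold.
Context (d : measure_display) (T : measurableType d) (R : realType).
Variables (Q : probability T R) (lr : T -> R) (A : R).
Hypotheses (mlr : measurable_fun setT lr) (lr_ge0 : forall t, 0 <= lr t).

(** The Shiryaev-Roberts statistic is a Markov chain: from r it moves to sr_step
    r t when t is observed. *)
Definition sr_step (r : R) (t : T) : R := (1 + r) * lr t.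

Lemma sr_step_ge0 r t : 0 <= r -> 0 <= sr_step r t.
Proof. by move=> r0; rewrite mulr_ge0// addr_ge0. Qed.

Lemma sr_step_le r r' t : r <= r' -> sr_step r t <= sr_step r' t.
Proof. by move=> rr'; rewrite ler_wpM2r// lerD2l. Qed.

Lemma measurable_sr_step r : measurable_fun setT (sr_step r).
Proof. by apply: measurable_funM => //; exact: measurable_cst. Qed.

Section Comparison.

Definition killed (g : R -> R) (r : R) (t : T) : R :=
  if sr_step r t < A then g (sr_step r t) else 0.

Lemma measurable_killed g r : measurable_fun setT g ->
  measurable_fun setT (killed g r).
Proof.
move=> mg; apply: measurable_fun_ifT => //.
- by apply: measurable_fun_ltr => //; exact: measurable_sr_step.
- by apply: measurableT_comp mg _; exact: measurable_sr_step.
Qed.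

(** S r and L r stand for the expected sum of the values of the chain before its
    first passage above A, and for the expected time of that passage, when the
    chain starts at r; the starting point is counted even if it is above A.
    Finally a m r is the probability that the passage takes more than m steps. *)
Variables (S L : R -> R) (a : nat -> R -> R) (M : R).
Hypotheses (A_gt0 : 0 < A) (M_ge0 : 0 <= M)
  (mS : measurable_fun setT S) (mL : measurable_fun setT L)
  (ma : forall m, measurable_fun setT (a m))
  (S_ge0 : forall r, 0 <= r -> 0 <= S r) (L_ge0 : forall r, 0 <= r -> 0 <= L r)
  (a_ge0 : forall m r, 0 <= r -> 0 <= a m r)
  (S_le : forall r, 0 <= r <= A -> S r <= M) (L_le : forall r, 0 <= r -> L r <= M)
  (LE : forall r, 0 <= r -> ((L r)%:E = 1 + \int[Q]_t (killed L r t)%:E)%E)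
  (SE : forall r, 0 <= r -> ((S r)%:E = r%:E + \int[Q]_t (killed S r t)%:E)%E)
  (aE : forall m r, 0 <= r ->
     ((a m.+1 r)%:E = \int[Q]_t (killed (a m) r t)%:E)%E)
  (a0 : forall r, 0 <= r -> a 0%N r = 1)
  (a_small : forall r e, 0 <= r -> 0 < e -> exists m, a m r <= e).

Let killed_ge0 g r t : (forall s, 0 <= s -> 0 <= g s) -> 0 <= r ->
  0 <= killed g r t.
Proof. by move=> g0 r0; rewrite /killed; case: ifP => // _; exact/g0/sr_step_ge0. Qed.

Let int_killedL r : 0 <= r -> (\int[Q]_t (killed L r t)%:E = (L r - 1)%:E)%E.
Proof.
move=> r0; have := LE r0; set I := (\int[Q]_t _)%E.
by case: I => [i [->]| |]//; congr (_%:E); lra.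
Qed.

Let int_killedS r : 0 <= r -> (\int[Q]_t (killed S r t)%:E = (S r - r)%:E)%E.
Proof.
move=> r0; have := SE r0; set I := (\int[Q]_t _)%E.
by case: I => [i [->]| |]//; congr (_%:E); lra.
Qed.

Let L_ge1 r : 0 <= r -> 1 <= L r.
Proof.
move=> r0; rewrite -subr_ge0 -lee_fin -int_killedL//.
by apply: integral_ge0 => t _; rewrite lee_fin; exact: killed_ge0.
Qed.

(** The cost per unit of time at which, for a chain that stands exactly at A,
    stopping at once and running until the next passage above A are equally
    good. *)
Definition threshold_price : R := S A / L A.
Let c := threshold_price.

Let LA_gt0 : 0 < L A.
Proof. by apply: lt_le_trans (L_ge1 (ltW A_gt0)); exact: ltr01. Qed.

Let c_ge0 : 0 <= c.
Proof. by rewrite divr_ge0// ?S_ge0 ?L_ge0 ?ltW. Qed.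

Let SA : S A = c * L A.
Proof. by rewrite /c /threshold_price divfK// gt_eqF. Qed.

(** The expected cost of running from r until the next passage above A when each
    unit of time costs the current value of the chain minus the price. *)
Definition excess (r : R) : R := S r - c * L r.

Let int_lin (f g h : T -> R) (x y : R) :
  measurable_fun setT f -> measurable_fun setT g -> measurable_fun setT h ->
  (forall t, 0 <= f t) -> (forall t, 0 <= g t) -> (forall t, 0 <= h t) ->
  0 <= x -> 0 <= y ->
  (\int[Q]_t (f t + x * g t + y * h t)%:E =
   \int[Q]_t (f t)%:E + x%:E * \int[Q]_t (g t)%:E + y%:E * \int[Q]_t (h t)%:E)%E.
Proof.
move=> mf mg mh f0 g0 h0 x0 y0.
under eq_integral => t _ do rewrite !EFinD !EFinM.
have mE (k : T -> R) : measurable_fun setT k -> measurable_fun setT (fun t => (k t)%:E).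
  by move=> mk; exact/measurable_EFinP.
rewrite ge0_integralD//; last first.
- by apply: emeasurable_funM; [exact: measurable_cst|exact: mE].
- by move=> t _; rewrite mule_ge0// lee_fin.
- apply: emeasurable_funD; first exact: mE.
  by apply: emeasurable_funM; [exact: measurable_cst|exact: mE].
- by move=> t _; rewrite adde_ge0 ?mule_ge0// lee_fin.
rewrite ge0_integralD//; last first.
- by apply: emeasurable_funM; [exact: measurable_cst|exact: mE].
- by move=> t _; rewrite mule_ge0// lee_fin.
- exact: mE.
- by move=> t _; rewrite lee_fin.
by rewrite !ge0_integralZl//; try exact: mE; move=> *; rewrite lee_fin.
Qed.

(** The one-step equations LE, SE and aE turn a comparison of the next positions
    into a comparison of the current ones. *)
Let killed_compare (x : R) (m : nat) r r' : 0 <= r -> r <= r' -> 0 <= x ->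
  (forall t, killed S r t + c * killed L r' t + 0 * killed (a m) r t <=
    killed S r' t + c * killed L r t + x * killed (a m) r t) ->
  S r - r + c * (L r' - 1) <= S r' - r' + c * (L r - 1) + x * a m.+1 r.
Proof.
move=> r0 rr' x0 H; have r'0 := le_trans r0 rr'.
have mk := measurable_killed.
have : (\int[Q]_t (killed S r t + c * killed L r' t + 0 * killed (a m) r t)%:E <=
  \int[Q]_t (killed S r' t + c * killed L r t + x * killed (a m) r t)%:E)%E.
  apply: ge0_le_integral => //.
  - move=> t _; rewrite lee_fin mul0r addr0; apply: addr_ge0; [|apply: mulr_ge0 => //]; exact: killed_ge0.
  - apply/measurable_EFinP; apply: measurable_funD; [apply: measurable_funD|];
      rewrite ?mul0r//; try exact: mk; apply: measurable_funM => //; exact: mk.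
  - apply/measurable_EFinP; apply: measurable_funD; [apply: measurable_funD|];
      try exact: mk; apply: measurable_funM => //; exact: mk.
  - by move=> t _; rewrite lee_fin.
rewrite !int_lin//; try exact: mk; try (by move=> t; exact: killed_ge0); last 2 first.
  by move=> t; apply: killed_ge0 => // s; exact: a_ge0.
  by move=> t; apply: killed_ge0 => // s; exact: a_ge0.
rewrite !int_killedS// !int_killedL// -!aE// -!EFinM -!EFinD lee_fin.
by rewrite mul0r addr0.
Qed.

Let MM : R := M + c * M.

Let MM_ge0 : 0 <= MM.
Proof. exact: addr_ge0 M_ge0 (mulr_ge0 c_ge0 M_ge0). Qed.

(** Two chains driven by the same observations keep their order. While both are
    below A their excesses are compared at the next step; when only the upper
    one has passed A, the lower one is compared with a chain started at A, whose
    excess is 0. Each step keeps a discrepancy only if the lower chain has not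
    stopped, whence the factor a m r. *)
Let excess_osc m r r' : 0 <= r -> r <= r' -> r' <= A ->
  excess r - excess r' <= MM * a m r.
Proof.
elim: m r r' => [|m IH] r r' r0 rr' r'A; have r'0 := le_trans r0 rr'.
  rewrite a0// mulr1 /excess /MM.
  have : S r <= M by rewrite S_le// r0 (le_trans rr').
  have : 0 <= S r' by exact: S_ge0.
  have : c * L r' <= c * M by rewrite ler_wpM2l// L_le.
  have : 0 <= c * L r by apply: mulr_ge0 => //; exact: L_ge0.
  lra.
suff : S r - r + c * (L r' - 1) <= S r' - r' + c * (L r - 1) + MM * a m.+1 r.
  by rewrite /excess; lra.
apply: killed_compare => // t; rewrite mul0r addr0 /killed.
have s0 := sr_step_ge0 t r0; have ss' := sr_step_le t rr'.
case: (ltP (sr_step r' t) A) => s'A.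
  rewrite (le_lt_trans ss' s'A).
  by have := IH _ _ s0 ss' (ltW s'A); rewrite /excess; lra.
case: (ltP (sr_step r t) A) => sA; last by rewrite !mulr0 !addr0.
by have := IH _ _ s0 (ltW sA) (lexx A); rewrite /excess SA; lra.
Qed.

Lemma excess_nondecreasing r r' : 0 <= r -> r <= r' -> r' <= A ->
  excess r <= excess r'.
Proof.
move=> r0 rr' r'A; rewrite -subr_le0; apply/ler_addgt0Pr => e e0; rewrite add0r.
have MM1 : 0 < MM + 1 by exact: ltr_wpDl MM_ge0 ltr01.
have [m Hm] := a_small r0 (divr_gt0 e0 MM1).
apply: le_trans (excess_osc m r0 rr' r'A) _.
apply: le_trans (_ : (MM + 1) * a m r <= _).
  by rewrite ler_wpM2r ?a_ge0// lerDl.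
by rewrite mulrC -ler_pdivlMr.
Qed.

Let excessA : excess A = 0.
Proof. by rewrite /excess SA subrr. Qed.

Let excess_above r : A <= r -> 0 <= excess r.
Proof.
move=> Ar; have A0 := ltW A_gt0; have r0 := le_trans A0 Ar.
suff : S A - A + c * (L r - 1) <= S r - r + c * (L A - 1) + 0 * a 1%N A.
  by rewrite mul0r; have := excessA; rewrite /excess; lra.
apply: killed_compare => // t; rewrite mul0r !addr0 /killed.
have s0 := sr_step_ge0 t A0; have ss' := sr_step_le t Ar.
case: (ltP (sr_step r t) A) => s'A.
  rewrite (le_lt_trans ss' s'A).
  by have := excess_nondecreasing s0 ss' (ltW s'A); rewrite /excess; lra.
case: (ltP (sr_step A t) A) => sA; last by rewrite !mulr0.
by have := excess_nondecreasing s0 (ltW sA) (lexx A); rewrite excessA /excess; lra.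
Qed.

(** w is minus the value of the stopping problem with running cost r - c, which
    is the excess below A and 0 above A. The inequality says that neither
    stopping below A nor continuing above A can pay: the excess is nonpositive
    below A and nonnegative above A. *)
Lemma threshold_verification : exists w : R -> R, [/\ measurable_fun setT w,
  (forall r, 0 <= w r),
  (forall r, 0 <= r ->
     (c%:E + \int[Q]_t (w (sr_step r t))%:E <= (r + w r)%:E)%E) &
  S 0 + w 0 = c * L 0].
Proof.
pose w r := if (0 <= r) && (r < A) then c * L r - S r else 0.
have wk r t : 0 <= r -> w (sr_step r t) = if sr_step r t < A then
    c * L (sr_step r t) - S (sr_step r t) else 0.
  by move=> r0; rewrite /w sr_step_ge0.
have w0 r : 0 <= w r.
  rewrite /w; case: ifP => // /andP[r0 rA].
  by have := excess_nondecreasing r0 (ltW rA) (lexx A); rewrite excessA /excess; lra.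
have mw : measurable_fun setT w.
  apply: measurable_fun_ifT => //.
    by apply: measurable_and; [exact: measurable_fun_ler|exact: measurable_fun_ltr].
  by apply: measurable_funB => //; exact: measurable_funM.
exists w; split=> //.
- move=> r r0.
  have mws : measurable_fun setT (fun t => w (sr_step r t)).
    by apply: measurableT_comp mw _; exact: measurable_sr_step.
  have H : (\int[Q]_t (killed S r t + 1 * w (sr_step r t) + 0 * 0)%:E =
    \int[Q]_t (0 + c * killed L r t + 0 * 0)%:E)%E.
    apply: eq_integral => t _; rewrite wk// /killed; congr (_%:E).
    by case: ifP => _; lra.
  move: H; rewrite !int_lin//; first last.
  - by move=> t; exact: killed_ge0.
  - exact: measurable_killed.
  - by move=> t; exact: killed_ge0.
  - exact: measurable_killed.
  rewrite int_killedS// int_killedL// !mul0e !adde0 integral0 add0e mul1e -EFinM.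
  set I := (\int[Q]_t _)%E; case: I => [i| |]//.
  rewrite -!EFinD => -[H]; rewrite lee_fin.
  case: (ltP r A) => rA; first by rewrite /w r0 rA /=; lra.
  by have := excess_above rA; have := w0 r; rewrite /excess; lra.
- by rewrite /w lexx A_gt0 /=; lra.
Qed.

End Comparison.
End Threshold.

(** * Expected length and area of a run of the statistic *)

Lemma nneseries_recl0 (R : realType) (f : nat -> \bar R) :
  (forall k, 0 <= f k)%E ->
  (\sum_(k <oo) f k = f 0%N + \sum_(k <oo) f k.+1)%E.
Proof.
move=> f0; rewrite nneseries_recl//; congr (_ + _)%E.
apply/cvg_lim => //; rewrite -cvg_shiftS.
under eq_fun do rewrite big_add1 /=.
exact: is_cvg_nneseries.
Qed.

Section Killing.
Context (d : measure_display) (T : measurableType d) (R : realType).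
Variables (Q : probability T R) (lr : T -> R) (A : R).
Hypotheses (mlr : measurable_fun setT lr) (lr_ge0 : forall t, 0 <= lr t).
Local Open Scope ereal_scope.

Definition kill (g : R -> \bar R) (r : R) : \bar R :=
  \int[Q]_t (if (sr_step lr r t < A)%R then g (sr_step lr r t) else 0).

Definition run_tail (m : nat) : R -> \bar R := iter m kill (fun=> 1).
(** The absolute value only serves to have a nonnegative function on all reals;
    the chain lives on the nonnegative ones. *)
Definition run_mean (m : nat) : R -> \bar R := iter m kill (fun r => `|r|%:E).

Let measurable_step2 :
  measurable_fun setT (fun z : R * T => sr_step lr z.1 z.2).
Proof.
apply: measurable_funM.
  by apply: measurable_funD; [exact: measurable_cst|exact: measurable_fst].
by apply: measurableT_comp mlr _; exact: measurable_snd.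
Qed.

Lemma measurable_kill_integrand (g : R -> \bar R) r : measurable_fun setT g ->
  measurable_fun setT
    (fun t => if (sr_step lr r t < A)%R then g (sr_step lr r t) else 0).
Proof.
move=> mg; have ms := @measurable_sr_step _ _ _ _ mlr r.
by apply: measurable_fun_ifT => //; [exact: measurable_fun_ltr|exact: measurableT_comp].
Qed.

Lemma measurable_kill (g : R -> \bar R) : measurable_fun setT g -> (forall r, 0 <= g r) ->
  measurable_fun setT (kill g).
Proof.
move=> mg g0.
pose f (z : R * T) := if (sr_step lr z.1 z.2 < A)%R then g (sr_step lr z.1 z.2) else 0.
apply: (@measurable_fun_fubini_tonelli_F _ _ R T _ Q f).
- apply: measurable_fun_ifT => //; first exact: measurable_fun_ltr.
  exact: measurableT_comp mg measurable_step2.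
- by move=> z; rewrite /f; case: ifP.
Qed.

Lemma kill_ge0 g r : (forall s, 0 <= g s) -> 0 <= kill g r.
Proof. by move=> g0; apply: integral_ge0 => t _; case: ifP. Qed.

Lemma le_kill (g g' : R -> \bar R) r r' : measurable_fun setT g -> measurable_fun setT g' ->
  (forall s, 0 <= g s) -> (forall s, 0 <= g' s) -> (0 <= r <= r')%R ->
  (forall s s', (0 <= s <= s')%R -> (s' < A)%R -> g s' <= g' s) ->
  kill g r' <= kill g' r.
Proof.
move=> mg mg' g0 g'0 /andP[r0 rr'] H; apply: ge0_le_integral => //.
- by move=> t _; case: ifP.
- exact: measurable_kill_integrand.
- exact: measurable_kill_integrand.
- move=> t _; have s0 := sr_step_ge0 lr_ge0 t r0; have ss := sr_step_le lr_ge0 t rr'.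
  case: (ltP (sr_step lr r' t) A) => sA; last by case: ifP.
  by rewrite (le_lt_trans ss sA) H// s0.
Qed.

Lemma killZ (k : R) (g : R -> \bar R) r : (0 <= k)%R -> measurable_fun setT g ->
  (forall s, 0 <= g s) -> kill (fun s => k%:E * g s) r = k%:E * kill g r.
Proof.
move=> k0 mg g0; rewrite /kill -ge0_integralZl//.
- by apply: eq_integral => t _; case: ifP => // _; rewrite mule0.
- exact: measurable_kill_integrand.
- by move=> t _; case: ifP.
Qed.

Lemma kill_nneseries (g : nat -> R -> \bar R) r :
  (forall m, measurable_fun setT (g m)) -> (forall m s, 0 <= g m s) ->
  kill (fun s => \sum_(m <oo) g m s) r = \sum_(m <oo) kill (g m) r.
Proof.
move=> mg g0; rewrite /kill -integral_nneseries//.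
- apply: eq_integral => t _; case: ifP => // _.
  by rewrite eseries0.
- by move=> m; exact: measurable_kill_integrand.
- by move=> m t _; case: ifP.
Qed.

Lemma run_tail_ge0 m r : 0 <= run_tail m r.
Proof. by elim: m r => [|m IH] r; rewrite /run_tail /= ?lee_fin//; exact: kill_ge0. Qed.

Lemma run_mean_ge0 m r : 0 <= run_mean m r.
Proof. by elim: m r => [|m IH] r; rewrite /run_mean /= ?lee_fin//; exact: kill_ge0. Qed.

Lemma measurable_run_tail m : measurable_fun setT (run_tail m).
Proof.
elim: m => [|m IH]; first exact: measurable_cst.
by apply: measurable_kill => // r; exact: run_tail_ge0.
Qed.

Lemma measurable_run_mean m : measurable_fun setT (run_mean m).
Proof.
elim: m => [|m IH].
  by apply/measurable_EFinP; exact: normr_measurable.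
by apply: measurable_kill => // r; exact: run_mean_ge0.
Qed.

Lemma run_tail_antitone m r r' : (0 <= r <= r')%R -> run_tail m r' <= run_tail m r.
Proof.
elim: m r r' => [//|m IH] r r' rr'.
apply: le_kill => //; try exact: measurable_run_tail; try exact: run_tail_ge0.
by move=> s s' ss' _; exact: IH.
Qed.

Definition run_length r := \sum_(m <oo) run_tail m r.
Definition run_area r := \sum_(m <oo) run_mean m r.

Lemma measurable_run_length : measurable_fun setT run_length.
Proof.
apply: ge0_emeasurable_sum => m; first by move=> x _ _; exact: run_tail_ge0.
by move=> _; exact: measurable_run_tail.
Qed.

Lemma measurable_run_area : measurable_fun setT run_area.
Proof.
apply: ge0_emeasurable_sum => m; first by move=> x _ _; exact: run_mean_ge0.
by move=> _; exact: measurable_run_mean.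
Qed.

Lemma run_length_ge0 r : 0 <= run_length r.
Proof. by apply: nneseries_ge0 => m _ _; exact: run_tail_ge0. Qed.

Lemma run_area_ge0 r : 0 <= run_area r.
Proof. by apply: nneseries_ge0 => m _ _; exact: run_mean_ge0. Qed.

Lemma run_lengthE r : run_length r = 1 + kill run_length r.
Proof.
rewrite kill_nneseries; [|exact: measurable_run_tail|exact: run_tail_ge0].
by rewrite /run_length nneseries_recl0// => k; exact: run_tail_ge0.
Qed.

Lemma run_areaE r : run_area r = `|r|%:E + kill run_area r.
Proof.
rewrite kill_nneseries; [|exact: measurable_run_mean|exact: run_mean_ge0].
by rewrite /run_area nneseries_recl0// => k; exact: run_mean_ge0.
Qed.


Variable B : R.
Hypotheses (A_gt0 : (0 < A)%R) (lengthB : run_length 0 = B%:E).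

Let length_le r : (0 <= r)%R -> run_length r <= B%:E.
Proof.
move=> r0; rewrite -lengthB; apply: lee_nneseries.
  by move=> i _ _; exact: run_tail_ge0.
by move=> n _; apply: run_tail_antitone; rewrite lexx r0.
Qed.

Let length_fin r : (0 <= r)%R -> run_length r \is a fin_num.
Proof.
by move=> r0; rewrite ge0_fin_numE ?run_length_ge0// (le_lt_trans (length_le r0))// ltry.
Qed.

Let mean_le m r : (0 <= r)%R -> run_mean m.+1 r <= A%:E * run_tail m.+1 r.
Proof.
have AA := ltW A_gt0.
have H k s : (0 <= s)%R -> (forall q, (0 <= q < A)%R -> run_mean k q <= A%:E * run_tail k q) ->
    run_mean k.+1 s <= A%:E * run_tail k.+1 s.
  move=> s0 IH; rewrite [X in _ <= _ * X]/run_tail /= -killZ//; last first.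
  - by move=> q; exact: run_tail_ge0.
  - exact: measurable_run_tail.
  apply: ge0_le_integral => //.
  - by move=> t _; case: ifP => // _; exact: run_mean_ge0.
  - exact: (measurable_kill_integrand s (measurable_run_mean k)).
  - apply: (@measurable_kill_integrand (fun q => A%:E * run_tail k q)).
    by apply: emeasurable_funM; [exact: measurable_cst|exact: measurable_run_tail].
  - move=> t _; case: ifP => // sA; apply: IH; rewrite sA andbT.
    exact: sr_step_ge0.
elim: m r => [|m IH] r r0; apply: H => // q /andP[q0 qA]; last exact: IH.
by rewrite /run_mean /run_tail /= mule1 lee_fin ger0_norm// ltW.
Qed.

Let area_le r : (0 <= r)%R -> run_area r <= (r + A * B)%:E.
Proof.
move=> r0; rewrite /run_area nneseries_recl0; last by move=> k; exact: run_mean_ge0.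
rewrite EFinD {1}/run_mean /= ger0_norm// leeD2l// EFinM.
apply: (@le_trans _ _ (A%:E * run_length r)); last first.
  by apply: lee_wpmul2l; [rewrite lee_fin ltW|exact: length_le].
rewrite /run_length nneseries_recl0; last by move=> k; exact: run_tail_ge0.
apply: (@le_trans _ _ (A%:E * \sum_(k <oo) run_tail k.+1 r)).
  rewrite -nneseriesZl; last by move=> k _; exact: run_tail_ge0.
  apply: lee_nneseries => [k _ _|k _]; first exact: (run_mean_ge0 k.+1).
  exact: mean_le.
by apply: lee_wpmul2l; [rewrite lee_fin ltW|rewrite leeDr// lee_fin].
Qed.

Let area_fin r : (0 <= r)%R -> run_area r \is a fin_num.
Proof.
by move=> r0; rewrite ge0_fin_numE ?run_area_ge0// (le_lt_trans (area_le r0))// ltry.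
Qed.

Let tail_fin m r : (0 <= r)%R -> run_tail m r \is a fin_num.
Proof.
move=> r0; rewrite ge0_fin_numE ?run_tail_ge0//.
apply: le_lt_trans (_ : run_length r < +oo).
  have := @nneseries_lim_ge R (run_tail^~ r) xpredT 0%N m.+1 (fun n _ _ => run_tail_ge0 n r).
  by apply: le_trans; rewrite big_nat_recr//= leeDr// sume_ge0// => i _; exact: run_tail_ge0.
by rewrite (le_lt_trans (length_le r0))// ltry.
Qed.

Let killedE (g : R -> \bar R) r : (0 <= r)%R ->
  (forall s, (0 <= s)%R -> g s \is a fin_num) ->
  \int[Q]_t (killed lr A (fine \o g) r t)%:E = kill g r.
Proof.
move=> r0 gf; apply: eq_integral => t _; rewrite /killed; case: ifP => //= _.
by rewrite fineK// gf// sr_step_ge0.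
Qed.

(** The area of a run is finite because the chain stays below A until the run
    ends, so threshold_verification applies to the expected length and area of a
    run. *)
Lemma optimal_threshold_pos : exists (c : R) (w : R -> R), [/\ (0 <= c)%R, measurable_fun setT w,
  (forall r, 0 <= w r)%R,
  (forall r, (0 <= r)%R ->
     c%:E + \int[Q]_t (w (sr_step lr r t))%:E <= (r + w r)%:E) &
  run_area 0 + (w 0)%:E = (c * B)%:E].
Proof.
have AA := ltW A_gt0; have AB : (0 <= B)%R by rewrite -lee_fin -lengthB run_length_ge0.
have mfine (g : R -> \bar R) : measurable_fun setT g -> measurable_fun setT (fine \o g).
  by move=> mg; apply: measurableT_comp mg.
pose S := fine \o run_area; pose L := fine \o run_length.
pose a m := fine \o run_tail m; pose M := (A + A * B + B)%R.
have ge (g : R -> \bar R) : (forall r, 0 <= g r) -> forall r, (0 <= r)%R -> (0 <= (fine \o g) r)%R.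
  by move=> g0 r _; apply: fine_ge0.
have := @threshold_verification _ T R Q lr A mlr lr_ge0 S L a M A_gt0.
case.
- by rewrite /M !addr_ge0// mulr_ge0.
- exact: (mfine _ measurable_run_area).
- exact: (mfine _ measurable_run_length).
- by move=> m; exact: (mfine _ (measurable_run_tail m)).
- exact: (ge _ run_area_ge0).
- exact: (ge _ run_length_ge0).
- by move=> m; exact: (ge _ (run_tail_ge0 m)).
- move=> r /andP[r0 rA]; rewrite -lee_fin /S /= fineK ?area_fin//.
  by apply: (le_trans (area_le r0)); rewrite lee_fin /M; lra.
- move=> r r0; rewrite -lee_fin /L /= fineK ?length_fin//.
  by apply: (le_trans (length_le r0)); rewrite lee_fin /M; have := mulr_ge0 AA AB; lra.
- move=> r r0; rewrite (killedE r0 length_fin).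
  by rewrite /L /= fineK ?length_fin// -run_lengthE.
- move=> r r0; rewrite (killedE r0 area_fin).
  by rewrite /S /= fineK ?area_fin// run_areaE ger0_norm.
- move=> m r r0; rewrite (killedE r0 (tail_fin m)).
  exact: (fineK (tail_fin m.+1 r0)).
- by move=> r r0.
- move=> r e r0 e0; apply: contrapT => H.
  have H1 m : (e <= a m r)%R.
    by rewrite leNgt; apply/negP => lt; apply: H; exists m; exact: ltW.
  have H2 n : (n%:R * e <= B)%R.
    rewrite -lee_fin; apply: le_trans (length_le r0).
    have := @nneseries_lim_ge R (run_tail^~ r) xpredT 0%N n (fun n _ _ => run_tail_ge0 n r).
    apply: le_trans; rewrite big_mkord mulr_natl -[in leLHS](card_ord n) -sumr_const -sumEFin.
    apply: lee_sum => i _; rewrite -[leRHS]fineK ?tail_fin// lee_fin; exact: H1.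
  have := H2 (Num.truncn (B / e)).+1.
  by rewrite -ler_pdivlMr// leNgt truncnS_gt.
move=> w [mw wb wv w0]; exists (threshold_price A S L), w; split => //.
- rewrite /threshold_price divr_ge0//; [exact: (ge _ run_area_ge0 _ AA)|exact: (ge _ run_length_ge0 _ AA)].
- rewrite -(fineK (area_fin (lexx 0%R))) -EFinD; congr (_%:E).
  by move: w0; rewrite /S /L /= lengthB.
Qed.

End Killing.

(** * Alarm times *)

Section FirstTime.

Lemma first_timeP (Q : nat -> Prop) (n : nat) :
  Q n -> (forall k, (k < n)%N -> ~ Q k) -> first_time Q = Some n.
Proof.
move=> Qn Qlt; rewrite /first_time; case: pselect => [e|[]]; last first.
  by exists n; apply/asboolP.
congr Some; case: ex_minnP => m /asboolP Qm mmin.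
apply/eqP; rewrite eqn_leq mmin; last by apply/asboolP.
by rewrite leqNgt; apply/negP => /Qlt.
Qed.

Lemma first_time_None (Q : nat -> Prop) : (forall n, ~ Q n) -> first_time Q = None.
Proof.
by move=> nQ; rewrite /first_time; case: pselect => // e; exfalso; case: e => n /asboolP /nQ.
Qed.

Lemma first_time_Some (Q : nat -> Prop) n : first_time Q = Some n ->
  Q n /\ forall k, (k < n)%N -> ~ Q k.
Proof.
rewrite /first_time; case: pselect => // e [<-]; case: ex_minnP => m Qm mmin.
split; first exact/asboolP.
move=> k km Qk; have := mmin k (asboolT Qk).
by rewrite leqNgt km.
Qed.

Lemma first_time_exists (Q : nat -> Prop) n : Q n -> first_time Q <> None.
Proof.
move=> Qn; rewrite /first_time; case: pselect => // -[].
by exists n; apply/asboolP.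
Qed.

Lemma time_le_first_time (Q : nat -> Prop) n :
  time_le (first_time Q) n <-> exists2 k, (k <= n)%N & Q k.
Proof.
case E : (first_time Q) => [m|] /=.
  have [Qm Qlt] := first_time_Some E; split; first by move=> mn; exists m.
  by move=> [k kn Qk]; rewrite (leq_trans _ kn)// leqNgt; apply/negP => /Qlt.
by split => // -[k _ /first_time_exists].
Qed.

End FirstTime.

Section Alarms.
Context (d : measure_display) (T : measurableType d) (N : (nat -> T) -> option nat).
Implicit Types x : nat -> T.

Lemma shift_dataD m k x : shift_data (m + k) x = shift_data k (shift_data m x).
Proof. by apply/funext => i; rewrite /shift_data addnA. Qed.

(** By definition alarm_time peels off the last cycle; the renewal argument
    peels off the first one. *)
Lemma alarm_timeS x j : alarm_time N x j.+1 =
  if N x is Some m then omap (addn m) (alarm_time N (shift_data m x) j) else None.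
Proof.
elim: j => [|j IH].
  rewrite /=; have -> : shift_data 0 x = x by [].
  by case: (N x) => //= m; rewrite addn0.
rewrite [LHS]/= -/(alarm_time N x j.+1) IH; case: (N x) => //= m.
case: (alarm_time N (shift_data m x) j) => //= w.
rewrite shift_dataD; case: (N _) => //= k; by rewrite addnA.
Qed.

Lemma first_alarm_from_ge x nu : time_ge (first_alarm_from N x nu) nu.
Proof.
rewrite /first_alarm_from; case E : first_alarm_index => [j|//].
by have [[]] := first_time_Some E.
Qed.

Lemma first_alarm_from_late x nu : time_ge (N x) nu -> first_alarm_from N x nu = N x.
Proof.
have A1 : alarm_time N x 1 = N x.
  by rewrite alarm_timeS; case: (N x) => //= m; rewrite addn0.
move=> Nx; rewrite /first_alarm_from (_ : first_alarm_index _ _ _ = Some 1%N)//.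
apply: first_timeP => [|[|//] _ []//].
by rewrite A1.
Qed.

Lemma first_alarm_from_early x nu m : N x = Some m -> (m < nu)%N ->
  first_alarm_from N x nu =
    omap (addn m) (first_alarm_from N (shift_data m x) (nu - m)).
Proof.
move=> Nx mnu.
have ge j : time_ge (alarm_time N x j.+1) nu <->
    time_ge (alarm_time N (shift_data m x) j) (nu - m).
  by rewrite alarm_timeS Nx; case: alarm_time => //= w; lia.
rewrite /first_alarm_from.
case E : (first_alarm_index N (shift_data m x) (nu - m)) => [j|].
  have [[j1 jge] jmin] := first_time_Some E.
  rewrite (_ : first_alarm_index N x nu = Some j.+1) ?alarm_timeS ?Nx//.
  apply: first_timeP; first by split => //; apply/ge.
  case=> [|k] kj [//_ /ge kge].
  apply: (jmin k); first by [].
  by split => //; case: k kj kge => //= _; lia.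
rewrite (_ : first_alarm_index N x nu = None)//.
apply: first_time_None => -[[]//|k] [_ /ge kge].
have k1 : (0 < k)%N by case: k kge => //=; lia.
by apply: (@first_time_exists (fun j => (1 <= j)%N /\
  time_ge (alarm_time N (shift_data m x) j) (nu - m)) k _ E).
Qed.

End Alarms.

Section Times.
Context (R : realType).
Local Open Scope ereal_scope.

Definition pending (t : option nat) (n : nat) : R :=
  if `[< time_le t n >] then 0%R else 1%R.

Lemma pendingS m n : pending (Some m) n = (n < m)%N%:R.
Proof.
rewrite /pending ltnNge; case: asboolP => /=; first by move=> ->.
by move=> /negP/negbTE ->.
Qed.

Lemma pending_None n : pending None n = 1%R.
Proof. by rewrite /pending; case: asboolP. Qed.

(** Truncated difference of times as a series of indicators: its expectation is
    a series of probabilities that the rule is still running. *)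
Definition late (t : option nat) (k : nat) : \bar R :=
  \sum_(n <oo) (if (k <= n)%N then pending t n else 0)%:E.

Let count_from k m :
  \sum_(0 <= n < m) (if (k <= n)%N then 1%R else 0%R)%:E = (m - k)%N%:R%:E :> \bar R.
Proof.
elim: m => [|m IH]; first by rewrite big_nil sub0n.
rewrite big_nat_recr//= IH -EFinD; congr (_%:E); case: leqP => km.
  by rewrite subSn// -natr1.
by rewrite addr0; congr (_%:R); lia.
Qed.

Lemma pending_ge0 t n : (0 <= pending t n)%R.
Proof. by rewrite /pending; case: ifP. Qed.

Let late_term_ge0 t k n : 0 <= (if (k <= n)%N then pending t n else 0)%:E.
Proof. by rewrite lee_fin; case: ifP => // _; exact: pending_ge0. Qed.

Lemma late_Some m k : late (Some m) k = (m - k)%N%:R%:E.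
Proof.
rewrite /late (nneseries_split 0%N m)//= add0n eseries0 ?adde0; last first.
  move=> n mn _; rewrite pendingS ltnNge mn /=; by case: ifP.
rewrite -count_from big_nat_cond [RHS]big_nat_cond.
by apply: eq_bigr => n /andP[/andP[_ nm] _]; rewrite pendingS nm.
Qed.

Lemma late_None k : late None k = +oo.
Proof.
apply/eqyP => A A0; apply: (@le_trans _ _ (\sum_(0 <= n < k + (Num.truncn A).+1)
    (if (k <= n)%N then pending None n else 0)%:E)).
  under eq_bigr do rewrite pending_None.
  rewrite count_from addKn lee_fin ltW//; exact: truncnS_gt.
exact: nneseries_lim_ge.
Qed.

Lemma late0 t : late t 0 = etime R t.
Proof. by case: t => [m|]; rewrite ?late_None// late_Some subn0. Qed.

Lemma late_etime t k : time_ge t k -> etime R t - k%:R%:E = late t k.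
Proof.
case: t => [m|] /= km; last by rewrite late_None.
by rewrite late_Some natrB.
Qed.

Lemma late_eq0 m k : (m <= k)%N -> late (Some m) k = 0.
Proof. by move=> mk; rewrite late_Some (eqP mk). Qed.

Lemma late_ge0 t k : 0 <= late t k.
Proof. by apply: nneseries_ge0 => n _ _. Qed.

Lemma late_addn m t k : (m <= k)%N -> late (omap (addn m) t) k = late t (k - m).
Proof.
move=> mk; case: t => [b|] /=; last by rewrite !late_None.
by rewrite !late_Some; congr (_%:R%:E); lia.
Qed.

(** Either the first cycle reaches beyond time t, or it ends at some s.+1 <= t
    and the rule starts afresh from there. *)
Lemma late_first_alarm (d : measure_display) (T : measurableType d) (N : (nat -> T) -> option nat) x t :
  ~ time_le (N x) 0 ->
  late (first_alarm_from N x t.+1) t.+1 = late (N x) t.+1 +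
    \sum_(s < t) (if N x == Some s.+1 then 1%R else 0%R)%:E *
      late (first_alarm_from N (shift_data s.+1 x) (t - s.+1).+1) (t - s.+1).+1.
Proof.
move=> N0; have [tN|] := pselect (time_ge (N x) t.+1).
  rewrite first_alarm_from_late// big1 ?adde0// => s _.
  case: eqP => [Ns|_]; last by rewrite mul0e.
  by move: tN; rewrite Ns /= ltnS leqNgt ltn_ord.
case Nx : (N x) => [[|m]|]//=; first by case: N0; rewrite Nx.
move=> /negP; rewrite -ltnNge ltnS => mt.
rewrite late_eq0 1?ltnW// add0e (bigD1 (Ordinal mt))//= eqxx mul1e big1 ?adde0.
  rewrite (first_alarm_from_early Nx)// late_addn 1?ltnW//.
  by rewrite (_ : (t.+1 - m.+1 = (t - m.+1).+1)%N)//; lia.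
move=> s; rewrite -val_eqE /= => sm.
by rewrite ifF ?mul0e//; apply/eqP => -[ms]; rewrite ms eqxx in sm.
Qed.

End Times.

(** * The renewal equation for the delay *)

Section RenewalAlgebra.
Context (R : realType).
Variables (p u : nat -> R) (D delay : nat -> \bar R).
Hypotheses (p0 : p 0%N = 1) (p_noninc : forall n, p n.+1 <= p n).
Hypotheses (u0 : u 0%N = 1)
  (uS : forall n, u n.+1 = \sum_(i < n.+1) (p i - p i.+1) * u (n - i)%N).
Hypothesis D_ge0 : forall k, (0 <= D k)%E.
Local Open Scope ereal_scope.
Hypothesis delayE : forall t, delay t = D t +
  \sum_(s < t) (p s - p s.+1)%:E * delay (t - s.+1)%N.

(** The sequence u solves the same equation with a unit source at time 0. *)
Lemma renewal_equation_solution t :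
  delay t = \sum_(s < t.+1) (u s)%:E * D (t - s)%N.
Proof.
have u_ge0 := renewal_ge0 p_noninc u0 uS.
elim/ltn_ind: t => t IH; rewrite delayE big_ord_recl u0 mul1e subn0; congr (_ + _).
transitivity (\sum_(i < t) \sum_(0 <= k < t - i)
    (p i - p i.+1)%:E * ((u k)%:E * D (t - (i + k).+1)%N)).
  apply: eq_bigr => i _; rewrite IH; last by have := ltn_ord i; lia.
  rewrite ge0_sume_distrr; last by move=> s _; rewrite mule_ge0// lee_fin.
  rewrite big_mkord (_ : (t - i.+1).+1 = t - i)%N; last by have := ltn_ord i; lia.
  by apply: eq_bigr => k _; rewrite -addSn subnDA.
transitivity (\sum_(i < t) \sum_((0 - i)%N <= k < (t - i)%N)
    (p i - p i.+1)%:E * ((u k)%:E * D (t - (i + k).+1)%N)).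
  by apply: eq_bigr => i _; rewrite sub0n.
rewrite -(sum_diagonals (fun i k =>
  (p i - p i.+1)%:E * ((u k)%:E * D (t - (i + k).+1)%N))) big_mkord.
apply: eq_bigr => n _; rewrite lift0 uS -sumEFin ge0_sume_distrl; last first.
  by move=> i _; rewrite lee_fin mulr_ge0// subr_ge0.
apply: eq_bigr => i _; rewrite EFinM -muleA subnKC//.
by rewrite -ltnS.
Qed.

Lemma renewal_sequence_exists (q : nat -> R) : exists v : nat -> R, v 0%N = 1%R /\
  forall n, v n.+1 = (\sum_(i < n.+1) (q i - q i.+1) * v (n - i)%N)%R.
Proof.
pose fix vs n : seq R := if n is n'.+1 then
  let s := vs n' in (\sum_(i < n'.+1) (q i - q i.+1) * s`_i)%R :: s else [:: 1%R].
have vsE n i : (i <= n)%N -> (vs n)`_i = (vs (n - i)%N)`_0.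
  elim: n i => [|n IH] [|i]//; rewrite ltnS => /IH; by rewrite subSS.
exists (fun n => (vs n)`_0); split => // n /=.
by apply: eq_bigr => i _; rewrite vsE// -ltnS.
Qed.

End RenewalAlgebra.

Section Rules.
Context (d : measure_display) (T : measurableType d) (R : realType).
Notation dataseq := (dataseq T).
Local Open Scope ereal_scope.
Variables (q0 q1 : probability T R) (Linf : probability dataseq R)
  (Lam : nat -> probability dataseq R).
Hypotheses (LinfE : product_law Linf (fun=> q0))
  (LamE : forall j, product_law (Lam j) (fun i => if (i < j)%N then q0 else q1 : set T -> \bar R)).

(** The properties of a stopping time that the argument uses; a rule that stops
    at time 0 would never let time pass. *)
Definition detection_rule (N : dataseq -> option nat) :=
  [/\ forall n, measurable [set x : dataseq | time_le (N x) n],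
      forall n, prefix_determined n (fun x : dataseq => time_le (N x) n)
    & forall x, ~ time_le (N x) 0].

Variable N : dataseq -> option nat.
Hypothesis ruleN : detection_rule N.

Lemma measurable_pending n : measurable_fun setT (fun x => pending R (N x) n).
Proof.
have [mN _ _] := ruleN.
rewrite (_ : (fun x => _) = \1_(~` [set x : dataseq | time_le (N x) n])).
  by apply: measurable_indic; exact: measurableC.
apply/funext => x; rewrite indicE /pending; case: asboolP => H.
  by rewrite memNset//= => /(_ H).
by rewrite mem_set.
Qed.

Lemma pending_determined n : prefix_determined n (fun x => pending R (N x) n).
Proof.
by have [_ dN _] := ruleN => x y xy; rewrite /pending (dN n x y xy).
Qed.

Lemma pending_noninc x n : (pending R (N x) n.+1 <= pending R (N x) n)%R.
Proof.
case: (N x) => [m|]; last by rewrite !pending_None.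
rewrite !pendingS ler_nat; by case: (ltnP n.+1 m) => // /ltnW ->.
Qed.

Lemma pending0 x : pending R (N x) 0 = 1%R.
Proof. by have [_ _ N0] := ruleN; rewrite /pending; case: asboolP => // /N0. Qed.

Lemma stop_pending x s : (if N x == Some s.+1 then 1%R else 0%R) =
  (pending R (N x) s - pending R (N x) s.+1)%R.
Proof.
have := pending0 x; case: (N x) => [m|] p0; last by rewrite !pending_None subrr.
rewrite !pendingS; case: eqP => [[->]|nm]; first by rewrite ltnSn ltnn subr0.
have [sm|ms] := ltnP s m; last by rewrite ltnNge (leqW ms) subrr.
have nm' : m <> s.+1 by move=> e; apply: nm; rewrite e.
by have -> : (s.+1 < m)%N; [lia|rewrite subrr].
Qed.

Definition tail_prob (n : nat) : R := fine (\int[Linf]_x (pending R (N x) n)%:E).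

Lemma tail_probE n : \int[Linf]_x (pending R (N x) n)%:E = (tail_prob n)%:E.
Proof.
have I0 : 0 <= \int[Linf]_x (pending R (N x) n)%:E.
  by apply: integral_ge0 => x _; rewrite lee_fin pending_ge0.
rewrite /tail_prob fineK// ge0_fin_numE//.
apply: (@le_lt_trans _ _ (\int[Linf]_x 1)).
  apply: ge0_le_integral => //.
  - by move=> x _; rewrite lee_fin pending_ge0.
  - by apply/measurable_EFinP; exact: measurable_pending.
  - by move=> x _; rewrite lee_fin /pending; case: ifP.
by rewrite integral_cst_prob ltry.
Qed.

Lemma tail_prob0 : tail_prob 0 = 1%R.
Proof.
rewrite /tail_prob; under eq_integral do rewrite pending0.
by rewrite integral_cst_prob.
Qed.

Lemma tail_prob_ge0 n : (0 <= tail_prob n)%R.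
Proof.
by apply: fine_ge0; apply: integral_ge0 => x _; rewrite lee_fin pending_ge0.
Qed.

Lemma tail_prob_noninc n : (tail_prob n.+1 <= tail_prob n)%R.
Proof.
rewrite -lee_fin -!tail_probE; apply: ge0_le_integral => //.
- by move=> x _; rewrite lee_fin pending_ge0.
- by apply/measurable_EFinP; exact: measurable_pending.
- by apply/measurable_EFinP; exact: measurable_pending.
- by move=> x _; rewrite lee_fin pending_noninc.
Qed.

Lemma measurable_stop s :
  measurable_fun setT (fun x => (if N x == Some s.+1 then 1%R else 0%R) : R).
Proof.
rewrite (funext (fun x => stop_pending x s)).
by apply: measurable_funB; exact: measurable_pending.
Qed.

Lemma integral_stop s :
  \int[Linf]_x (if N x == Some s.+1 then 1%R else 0%R)%:E =
  (tail_prob s - tail_prob s.+1)%:E.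
Proof.
have : \int[Linf]_x (pending R (N x) s)%:E =
    \int[Linf]_x (if N x == Some s.+1 then 1%R else 0%R)%:E +
    \int[Linf]_x (pending R (N x) s.+1)%:E.
  rewrite -ge0_integralD//.
  - by apply: eq_integral => x _; rewrite stop_pending -EFinD subrK.
  - by move=> x _; case: ifP.
  - by apply/measurable_EFinP; exact: measurable_stop.
  - by move=> x _; rewrite lee_fin pending_ge0.
  - by apply/measurable_EFinP; exact: measurable_pending.
rewrite !tail_probE; set I := \int[_]_x _.
by case: I => [i [->]| |]//; rewrite addrK.
Qed.

Lemma stop_determined s : prefix_determined s.+1
  (fun x => (if N x == Some s.+1 then 1%R else 0%R) : R).
Proof.
move=> x y xy; rewrite !stop_pending; congr (_ - _)%R; apply: pending_determined => // i si.
by apply: xy; rewrite ltnS ltnW.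
Qed.

Let late_term k n := fun x : dataseq => (if (k <= n)%N then pending R (N x) n else 0)%:E.

Let measurable_late_term k n : measurable_fun setT (late_term k n).
Proof.
rewrite /late_term; apply/measurable_EFinP; case: (k <= n)%N.
  exact: measurable_pending.
exact: measurable_cst.
Qed.

Let late_term_ge0 k n x : 0 <= late_term k n x.
Proof. by rewrite /late_term lee_fin; case: ifP => // _; exact: pending_ge0. Qed.

Lemma measurable_late k : measurable_fun setT (fun x => late R (N x) k).
Proof.
apply: ge0_emeasurable_sum => n; first by move=> x _ _; exact: late_term_ge0.
by move=> _; exact: measurable_late_term.
Qed.

Lemma integral_late (m : probability dataseq R) k : \int[m]_x late R (N x) k =
  \sum_(n <oo) \int[m]_x (if (k <= n)%N then pending R (N x) n else 0)%:E.
Proof.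
rewrite -integral_nneseries//; first by move=> n; exact: measurable_late_term.
by move=> n x _; exact: late_term_ge0.
Qed.

Lemma mean_tail : \int[Linf]_x etime R (N x) = \sum_(n <oo) (tail_prob n)%:E.
Proof.
under eq_integral do rewrite -late0.
by rewrite integral_late; apply: eq_eseriesr => n _; exact: tail_probE.
Qed.

Definition first_alarm_delay t (x : dataseq) := late R (first_alarm_from N x t.+1) t.+1.

Let first_alarm_delayE t x : first_alarm_delay t x = late R (N x) t.+1 +
  \sum_(s < t) (if N x == Some s.+1 then 1%R else 0%R)%:E *
    first_alarm_delay (t - s.+1) (shift_data s.+1 x).
Proof. by have [_ _ N0] := ruleN; exact: late_first_alarm. Qed.

Let first_alarm_delay_ge0 t x : 0 <= first_alarm_delay t x.
Proof. exact: late_ge0. Qed.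

Lemma measurable_first_alarm_delay t : measurable_fun setT (first_alarm_delay t).
Proof.
elim/ltn_ind: t => t IH.
rewrite (funext (first_alarm_delayE t)).
apply: emeasurable_funD; first exact: measurable_late.
apply: emeasurable_sum => s; apply: emeasurable_funM.
  by apply/measurable_EFinP; exact: measurable_stop.
apply: (measurableT_comp (IH _ _) (measurable_shift s.+1)).
by have := ltn_ord s; lia.
Qed.

Definition one_cycle_delay t := \int[Lam t]_x late R (N x) t.+1.
Definition delay t := \int[Lam t]_x first_alarm_delay t x.

Lemma one_cycle_delay_ge0 t : 0 <= one_cycle_delay t.
Proof. by apply: integral_ge0 => x _; exact: late_ge0. Qed.

(** The expectation of late_first_alarm: the data after a first cycle of length
    s.+1 <= t are independent of that cycle, and the change is then t - s.+1
    observations ahead. *)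
Lemma renewal_equation t : delay t = one_cycle_delay t +
  \sum_(s < t) (tail_prob s - tail_prob s.+1)%:E * delay (t - s.+1)%N.
Proof.
rewrite /delay; under eq_integral do rewrite first_alarm_delayE.
have stop0 s x : 0 <= (if N x == Some s.+1 then 1%R else 0%R)%:E :> \bar R by case: ifP.
have mterm (s : 'I_t) : measurable_fun setT (fun x : dataseq =>
    (if N x == Some s.+1 then 1%R else 0%R)%:E *
    first_alarm_delay (t - s.+1) (shift_data s.+1 x)).
  apply: emeasurable_funM; first by apply/measurable_EFinP; exact: measurable_stop.
  exact: (measurableT_comp (measurable_first_alarm_delay _) (measurable_shift s.+1)).
have term0 (s : 'I_t) x : 0 <= (if N x == Some s.+1 then 1%R else 0%R)%:E *
    first_alarm_delay (t - s.+1) (shift_data s.+1 x).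
  by rewrite mule_ge0.
rewrite ge0_integralD//; last first.
- exact: emeasurable_sum.
- by move=> x _; apply: sume_ge0 => s _.
- exact: measurable_late.
- by move=> x _; exact: late_ge0.
congr (_ + _); rewrite ge0_integral_sum//; apply: eq_bigr => s _.
rewrite -{1}(subnKC (ltn_ord s)) (integral_Lam_glue LinfE LamE)//.
under eq_integral => x _.
  under eq_integral => y _ do
    rewrite (glue_determined _ _ (@stop_determined s)) glue_suffix.
  rewrite ge0_integralZl//; last exact: measurable_first_alarm_delay.
  over.
rewrite ge0_integralZr//.
- by rewrite integral_stop.
- by apply/measurable_EFinP; exact: measurable_stop.
- by apply: integral_ge0.
Qed.

End Rules.

(** * Lower bound for the delay of an arbitrary rule *)

Section Verification.
Context (d : measure_display) (T : measurableType d) (R : realType).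
Notation dataseq := (dataseq T).
Local Open Scope ereal_scope.
Variables (q0 q1 : probability T R) (Linf : probability dataseq R)
  (Lam : nat -> probability dataseq R).
Hypotheses (LinfE : product_law Linf (fun=> q0))
  (LamE : forall j, product_law (Lam j) (fun i => if (i < j)%N then q0 else q1 : set T -> \bar R)).
Variables (lr : T -> R) (G : set T).
Hypotheses (mlr : measurable_fun setT lr) (lr_ge0 : forall t, (0 <= lr t)%R)
  (lrE : density_ratio q0 q1 lr G).

(** The statistic computed from the observations of index at least a, which is 0
    at time a. *)
Definition sr (a n : nat) (x : dataseq) : R := (\sum_(a <= j < n) lr_prod lr j n x)%R.

Lemma sr_start a x : sr a a x = 0%R.
Proof. by rewrite /sr big_geq. Qed.

Lemma srS a n x : (a <= n)%N -> sr a n.+1 x = sr_step lr (sr a n x) (x n).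
Proof.
move=> an; rewrite /sr big_nat_recr//= /sr_step mulrDl mul1r addrC.
congr (_ + _)%R; first by rewrite /lr_prod big_nat1.
rewrite mulr_suml big_nat_cond [RHS]big_nat_cond; apply: eq_bigr => j /andP[/andP[_ jn] _].
by rewrite /lr_prod big_nat_recr// ltnW.
Qed.

Lemma sr_ge0 a n x : (0 <= sr a n x)%R.
Proof. by apply: sumr_ge0 => j _; exact: lr_prod_ge0. Qed.

Lemma measurable_sr a n : measurable_fun setT (sr a n).
Proof. by apply: measurable_sum => j; exact: measurable_lr_prod. Qed.

Lemma sr_determined a n : prefix_determined n (sr a n).
Proof.
by move=> x y xy; apply: eq_bigr => j _; exact: lr_prod_determined.
Qed.

Section Rule.
Variable N : dataseq -> option nat.
Hypothesis ruleN : detection_rule N.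
Local Notation pend n x := (pending R (N x) n).
Local Notation p := (tail_prob Linf N).

Definition sr_area (a n : nat) : \bar R := \int[Linf]_x (pend n x * sr a n x)%:E.

Let mpend n := @measurable_pending _ T R N ruleN n.

(** Adding up the probabilities that the rule is still running at time n, over
    the change points between a and n, is integrating the statistic over the
    event that it is still running: the change of measure contributes one
    product of likelihood ratios for each change point. *)
Lemma sr_area_change a n : (a <= n)%N ->
  sr_area a n <= \sum_(a <= j < n) \int[Lam j]_x (pend n x)%:E /\
  ((forall x i, (i < n)%N -> ~ G (x i) -> pend n x = 0%R) ->
   sr_area a n = \sum_(a <= j < n) \int[Lam j]_x (pend n x)%:E).
Proof.
move=> an.
have mpE : measurable_fun setT (fun x => (pend n x)%:E) by exact/measurable_EFinP.
have E : sr_area a n = \sum_(a <= j < n)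
    \int[Linf]_x ((pend n x)%:E * (lr_prod lr j n x)%:E).
  rewrite -ge0_integral_sum//.
  - by apply: eq_integral => x _; rewrite /sr mulr_sumr -sumEFin.
  - move=> j; apply: emeasurable_funM => //.
    by apply/measurable_EFinP; exact: measurable_lr_prod.
  - by move=> j x _; rewrite -EFinM lee_fin mulr_ge0 ?pending_ge0 ?lr_prod_ge0.
rewrite E; split.
  rewrite big_nat_cond [leRHS]big_nat_cond; apply: lee_sum => j /andP[/andP[_ jn] _].
  have [] // := @change_of_measure _ _ _ _ _ _ _ LinfE LamE _ G mlr lr_ge0 lrE j n
    (fun x => (pend n x)%:E) (ltnW jn) mpE.
  - by move=> x; rewrite lee_fin pending_ge0.
  - by move=> x y /(@pending_determined _ _ R _ ruleN n) ->.
move=> HG.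
rewrite big_nat_cond [RHS]big_nat_cond; apply: eq_bigr => j /andP[/andP[_ jn] _].
have [||_ ->//] := @change_of_measure _ _ _ _ _ _ _ LinfE LamE _ G mlr lr_ge0 lrE j n
    (fun x => (pend n x)%:E) (ltnW jn) mpE.
- by move=> x; rewrite lee_fin pending_ge0.
- by move=> x y /(@pending_determined _ _ R _ ruleN n) ->.
- by move=> x i ni nG; rewrite (HG x i).
Qed.

Lemma one_cycle_delayE k : one_cycle_delay Lam N k =
  \sum_(n <oo) \int[Lam k]_x (if (k < n)%N then pend n x else 0)%:E.
Proof. by rewrite /one_cycle_delay integral_late. Qed.

(** The delay for a change after k observations is the sum over all n > k of the
    probabilities that the rule still runs at n; only the terms n < m are kept. *)
Lemma sum_one_cycle_delay_ge a m :
  \sum_(a <= n < m) sr_area a n <= \sum_(a <= k < m) one_cycle_delay Lam N k.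
Proof.
apply: (@le_trans _ _ (\sum_(a <= n < m) \sum_(a <= k < m | (k < n)%N)
    \int[Lam k]_x (pend n x)%:E)).
  rewrite big_nat_cond [leRHS]big_nat_cond; apply: lee_sum => n /andP[/andP[an nm] _].
  apply: (le_trans (sr_area_change an).1).
  by rewrite (big_nat_widen _ _ m)// ltnW.
rewrite (exchange_big_dep xpredT)//=; apply: lee_sum => k _.
rewrite one_cycle_delayE.
apply: (@le_trans _ _ (\sum_(0 <= n < m)
    \int[Lam k]_x (if (k < n)%N then pend n x else 0)%:E)); last first.
  apply: nneseries_lim_ge => n _ _; apply: integral_ge0 => x _.
  by rewrite lee_fin; case: ifP => // _; exact: pending_ge0.
rewrite (big_nat_widenl a 0)// big_mkcondr big_mkcond /= big_nat_cond [leRHS]big_nat_cond.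
apply: lee_sum => n _; case: (ltnP k n) => kn; last by rewrite integral0.
case: (a <= n)%N => //; apply: integral_ge0 => x _; by rewrite lee_fin pending_ge0.
Qed.

Variables (c : R) (w : R -> R).
Hypotheses (c_ge0 : (0 <= c)%R) (mw : measurable_fun setT w)
  (w_ge0 : forall r, (0 <= w r)%R)
  (wE : forall r, (0 <= r)%R ->
     c%:E + \int[q0]_t (w (sr_step lr r t))%:E <= (r + w r)%:E).

Let reserve a n := \int[Linf]_x (pend n x * w (sr a n x))%:E.

Let mwsr a n : measurable_fun setT (fun x => w (sr a n x)).
Proof. exact: measurableT_comp mw (measurable_sr a n). Qed.

(** The inequality wE integrated over the event that the rule runs at time n, an
    event which is independent of the observation of index n. *)
Let reserve_step a n : (a <= n)%N ->
  (c * p n)%:E + reserve a n.+1 <= sr_area a n + reserve a n.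
Proof.
move=> an.
have mpE : measurable_fun setT (fun x => (pend n x)%:E) by exact/measurable_EFinP.
pose I (r : R) := \int[q0]_t (w (sr_step lr r t))%:E.
have mstep : measurable_fun setT (fun z : R * T => (w (sr_step lr z.1 z.2))%:E).
  apply/measurable_EFinP; apply: (measurableT_comp mw); apply: measurable_funM.
    by apply: measurable_funD; [exact: measurable_cst|exact: measurable_fst].
  exact: measurableT_comp mlr (@measurable_snd _ _ R T).
have mI : measurable_fun setT I.
  apply: (@measurable_fun_fubini_tonelli_F _ _ R T _ q0
    (fun z => (w (sr_step lr z.1 z.2))%:E)) => //.
  by move=> z; rewrite lee_fin.
have I0 r : 0 <= I r by apply: integral_ge0 => t _; rewrite lee_fin.
have mIsr : measurable_fun setT (fun x => I (sr a n x)).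
  exact: measurableT_comp mI (measurable_sr a n).
have E1 : reserve a n.+1 <= \int[Linf]_x ((pend n x)%:E * I (sr a n x)).
  pose H (z : dataseq * T) := (pend n z.1 * w (sr_step lr (sr a n z.1) z.2))%:E.
  have mH : measurable_fun setT H.
    apply: (@emeasurable_funM _ _ _ _ (fun z : dataseq * T => (pend n z.1)%:E)
      (fun z => (w (sr_step lr (sr a n z.1) z.2))%:E)).
      exact: measurableT_comp mpE (@measurable_fst _ _ dataseq T).
    have mpair : measurable_fun setT (fun z : dataseq * T => (sr a n z.1, z.2)).
      apply: measurable_fun_pair; last exact: (@measurable_snd _ _ dataseq T).
      exact: (measurableT_comp (measurable_sr a n) (@measurable_fst _ _ dataseq T)).
    exact: measurableT_comp mstep mpair.
  have H0 z : 0 <= H z by rewrite lee_fin mulr_ge0// pending_ge0.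
  rewrite (_ : \int[Linf]_x _ = \int[Linf]_x H (x, x n)); last first.
    rewrite (@integral_next_observation _ _ _ q0 _ LinfE n H)//; last first.
      move=> t x y xy; rewrite /H /= (@sr_determined a n x y xy).
      by rewrite (@pending_determined _ _ R _ ruleN n x y xy).
    apply: eq_integral => x _; rewrite /H /= /I -ge0_integralZl//.
    - by apply/measurable_EFinP; apply: (measurableT_comp mw); exact: measurable_sr_step.
    - by move=> t _; rewrite lee_fin.
    - by rewrite lee_fin pending_ge0.
  apply: ge0_le_integral => //.
  - by move=> x _; rewrite lee_fin mulr_ge0// pending_ge0.
  - by apply/measurable_EFinP; apply: measurable_funM => //; exact: measurable_pending.
  - have mp : measurable_fun setT (fun x : dataseq => (x, x n)).
      by apply: measurable_fun_pair; [exact: measurable_id|exact: measurable_coord].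
    exact: measurableT_comp mH mp.
  - move=> x _; rewrite /H /= srS// lee_fin ler_wpM2r//.
    exact: pending_noninc.
have cE : (c * p n)%:E = \int[Linf]_x (c%:E * (pend n x)%:E).
  rewrite ge0_integralZl//; first by rewrite tail_probE.
  by move=> x _; rewrite lee_fin pending_ge0.
apply: (@le_trans _ _ ((c * p n)%:E + \int[Linf]_x ((pend n x)%:E * I (sr a n x)))).
  by rewrite leeD2l.
rewrite cE /sr_area /reserve -!ge0_integralD//.
- apply: ge0_le_integral => //.
  + by move=> x _; rewrite adde_ge0 ?mule_ge0 ?lee_fin ?pending_ge0.
  + apply: emeasurable_funD; apply: emeasurable_funM => //.
  + apply: emeasurable_funD; apply/measurable_EFinP; apply: measurable_funM => //.
    exact: measurable_sr.
  + move=> x _; rewrite muleC -ge0_muleDr ?lee_fin// -EFinD -mulrDr EFinM.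
    by rewrite lee_wpmul2l ?lee_fin ?pending_ge0// wE// sr_ge0.
- by move=> x _; rewrite lee_fin mulr_ge0 ?pending_ge0 ?sr_ge0.
- by apply/measurable_EFinP; apply: measurable_funM => //; exact: measurable_sr.
- by move=> x _; rewrite lee_fin mulr_ge0 ?pending_ge0.
- by apply/measurable_EFinP; exact: measurable_funM.
- by move=> x _; rewrite mule_ge0 ?lee_fin ?pending_ge0.
- exact: emeasurable_funM.
- by move=> x _; rewrite mule_ge0 ?lee_fin ?pending_ge0.
- exact: emeasurable_funM.
Qed.

(** The inequalities reserve_step telescope. The last reserve is nonnegative and
    can be dropped, so no limit has to be taken. *)
Lemma sr_area_ge a m : (a <= m)%N ->
  (c * \sum_(a <= n < m) p n)%:E <= \sum_(a <= n < m) sr_area a n + (w 0%R)%:E.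
Proof.
move=> am.
have H : (c * \sum_(a <= n < m) p n)%:E + reserve a m <=
    \sum_(a <= n < m) sr_area a n + reserve a a.
  elim: m am => [|m IH] am.
    by move: am; rewrite leqn0 => /eqP ->; rewrite !big_geq// mulr0.
  move: am; rewrite leq_eqVlt => /predU1P[<-|]; first by rewrite !big_geq// mulr0.
  rewrite ltnS => am; rewrite !big_nat_recr//= mulrDr EFinD -addeA.
  apply: (@le_trans _ _ ((c * \sum_(a <= n < m) p n)%:E + (sr_area a m + reserve a m))).
    by rewrite leeD2l// reserve_step.
  rewrite addeCA [leRHS]addeAC [leRHS]addeC leeD2l//; exact: IH.
have r0 : 0 <= reserve a m.
  by apply: integral_ge0 => x _; rewrite lee_fin mulr_ge0// pending_ge0.
apply: (@le_trans _ _ (\sum_(a <= n < m) sr_area a n + reserve a a)).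
  by apply: le_trans H; rewrite leeDl.
rewrite leeD2l//.
apply: (@le_trans _ _ (\int[Linf]_x (w 0%R)%:E)); last by rewrite integral_cst_prob.
apply: ge0_le_integral => //.
- by move=> x _; rewrite lee_fin mulr_ge0// pending_ge0.
- by apply/measurable_EFinP; exact: measurable_funM.
- move=> x _; rewrite lee_fin sr_start.
  by rewrite /pending; case: ifP => _; rewrite ?mul0r ?mul1r.
Qed.

Lemma one_cycle_delay_lower_bound a m : (a <= m)%N ->
  (c * \sum_(a <= n < m) p n)%:E <=
    \sum_(a <= k < m) one_cycle_delay Lam N k + (w 0%R)%:E.
Proof.
move=> am; apply: (le_trans (sr_area_ge am)).
by rewrite leeD2r// sum_one_cycle_delay_ge.
Qed.

End Rule.
End Verification.

(** * The Shiryaev-Roberts rule *)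

Section ShiryaevRoberts.
Context (d : measure_display) (T : measurableType d) (R : realType).
Notation dataseq := (dataseq T).
Local Open Scope ereal_scope.
Variables (f0 f1 : T -> R).
Hypotheses (mf0 : measurable_fun setT f0) (mf1 : measurable_fun setT f1)
  (f0_ge0 : forall t, (0 <= f0 t)%R) (f1_ge0 : forall t, (0 <= f1 t)%R).

(** Since x / 0 = 0, this vanishes with f0, whereas likelihood_ratio is infinite
    where f0 vanishes and f1 does not; the two agree on finite_ratio. *)
Definition ratio (t : T) : R := (f1 t / f0 t)%R.
Definition finite_ratio : set T := [set t | (f0 t != 0%R) || (f1 t == 0%R)].

Lemma ratio_ge0 t : (0 <= ratio t)%R.
Proof. by rewrite divr_ge0. Qed.

Lemma measurable_finite_ratio : measurable finite_ratio.
Proof.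
rewrite (_ : finite_ratio = ~` (f0 @^-1` [set 0%R]) `|` f1 @^-1` [set 0%R]).
  apply: measurableU; [apply: measurableC|]; rewrite -[X in measurable X]setTI.
    exact: mf0.
  exact: mf1.
apply/seteqP; split => t /=; first by move=> /orP[/eqP|/eqP]; [left|right].
by move=> [f00|f10]; apply/orP; [left; apply/eqP|right; apply/eqP].
Qed.

Lemma measurable_ratio : measurable_fun setT ratio.
Proof.
apply: measurable_funM => //.
rewrite (_ : (fun x => _) = (fun x => f0 x `^ (-1))%R).
  exact: (measurableT_comp (@measurable_powR R (-1)%R) mf0).
by apply/funext => t; rewrite powR_inv1.
Qed.

Lemma likelihood_ratio_finite t : finite_ratio t ->
  likelihood_ratio f0 f1 t = (ratio t)%:E.
Proof.
rewrite /finite_ratio /= /likelihood_ratio /ratio inver.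
case: eqP => [->|_ _] /=; last by rewrite EFinM.
by move=> /eqP ->; rewrite invr0 mulr0 mul0e.
Qed.

Lemma likelihood_ratio_infinite t : ~ finite_ratio t ->
  likelihood_ratio f0 f1 t = +oo.
Proof.
move/negP; rewrite /finite_ratio /= negb_or negbK => /andP[/eqP f00 f10].
rewrite /likelihood_ratio f00 inver eqxx gt0_muley// lte_fin.
by rewrite lt_neqAle eq_sym f10 f1_ge0.
Qed.

Lemma likelihood_ratio_ge0 t : 0 <= likelihood_ratio f0 f1 t.
Proof. by rewrite mule_ge0 ?inve_ge0 ?lee_fin. Qed.

Lemma sr_stat_finite (x : dataseq) n :
  (forall i, (i < n)%N -> finite_ratio (x i)) ->
  sr_stat f0 f1 x n = (sr ratio 0 n x)%:E.
Proof.
move=> xG; rewrite /sr_stat /sr -sumEFin; apply: eq_bigr => k _.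
rewrite /lr_prod -prodEFin big_nat_cond [RHS]big_nat_cond.
by apply: eq_bigr => i /andP[/andP[_ /xG]] /likelihood_ratio_finite.
Qed.

Lemma sr_stat_infinite (x : dataseq) n : ~ finite_ratio (x n) ->
  sr_stat f0 f1 x n.+1 = +oo.
Proof.
move=> xG; rewrite /sr_stat big_nat_recr//= big_nat1.
rewrite likelihood_ratio_infinite// addey// -ltNye; apply: (@lt_le_trans _ _ 0); first exact: ltNyr.
by apply: sume_ge0 => k _; apply: prode_ge0 => i _; exact: likelihood_ratio_ge0.
Qed.

Variable A : R.
Local Notation srt := (sr_time f0 f1 A).

Lemma sr_time_leS (x : dataseq) n : time_le (srt x) n.+1 <->
  time_le (srt x) n \/ A%:E <= sr_stat f0 f1 x n.+1.
Proof.
split.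
  move=> /time_le_first_time[k]; rewrite leq_eqVlt => /predU1P[-> []|kn Qk].
    by right.
  by left; apply/time_le_first_time; exists k.
move=> [/time_le_first_time[k kn Qk]|An]; apply/time_le_first_time.
  by exists k => //; exact: leqW.
by exists n.+1.
Qed.

Lemma sr_time_gt0 (x : dataseq) : ~ time_le (srt x) 0.
Proof. by move=> /time_le_first_time[k]; rewrite leqn0 => /eqP -> []. Qed.

(** An infinite likelihood ratio makes the statistic infinite and raises an
    alarm at once. Until the alarm all ratios are therefore finite, and sr_stat
    is the real-valued statistic. *)
Lemma sr_time_pending (x : dataseq) n : ~ time_le (srt x) n <->
  forall i, (i < n)%N -> finite_ratio (x i) /\ (sr ratio 0 i.+1 x < A)%R.
Proof.
elim: n => [|n IH]; first by split=> // _; exact: sr_time_gt0.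
split.
  move=> H; have /IH Hn : ~ time_le (srt x) n by move=> h; apply: H; apply/sr_time_leS; left.
  move=> i; rewrite ltnS leq_eqVlt => /predU1P[->|]; last exact: Hn.
  have An : ~ A%:E <= sr_stat f0 f1 x n.+1 by move=> h; apply: H; apply/sr_time_leS; right.
  have xG : finite_ratio (x n).
    by apply: contrapT => nG; apply: An; rewrite sr_stat_infinite// leey.
  split=> //; rewrite ltNge; apply/negP => h; apply: An.
  rewrite sr_stat_finite ?lee_fin// => k; rewrite ltnS leq_eqVlt => /predU1P[->//|].
  by move=> /Hn[].
move=> H /sr_time_leS[|].
  by apply/IH => i ni; apply: H; rewrite ltnS ltnW.
rewrite sr_stat_finite; last by move=> i /H[].
by rewrite lee_fin leNgt; have [_ ->] := H n (ltnSn n).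
Qed.

Lemma sr_rule : detection_rule srt.
Proof.
split.
- move=> n; rewrite (_ : [set x : dataseq | _] = ~` \bigcap_(i in [set i | (i < n)%N])
    ([set x : dataseq | finite_ratio (x i)] `&` [set x | (sr ratio 0 i.+1 x < A)%R])).
    apply: measurableC; apply: fin_bigcap_measurable; first exact: finite_II.
    move=> i _; apply: measurableI; rewrite -[X in measurable X]setTI.
      exact: (measurable_coord i measurableT measurable_finite_ratio).
    have mb : measurable_fun setT (fun x : dataseq => (sr ratio 0 i.+1 x < A)%R).
      apply: measurable_fun_ltr; last exact: measurable_cst.
      exact: (measurable_sr measurable_ratio).
    exact: (mb measurableT [set true]).
  apply/seteqP; split => x /=; have [H1 H2] := sr_time_pending x n.
    by move=> xn xI; exact: (H2 xI xn).
  by move=> xI; apply: contrapT => /H1; exact: xI.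
- suff H n (x y : dataseq) : (forall i, (i < n)%N -> x i = y i) ->
      ~ time_le (srt y) n -> ~ time_le (srt x) n.
    move=> n x y xy; apply/propext; split; apply: contraPP; apply: H => //.
    by move=> i /xy.
  move=> xy /sr_time_pending yn; apply/sr_time_pending => i ni.
  have [yG ysr] := yn i ni; rewrite xy//; split => //.
  rewrite (@sr_determined _ _ _ ratio 0 i.+1 x y)// => k ki.
  by apply: xy; exact: leq_trans ki ni.
- exact: sr_time_gt0.
Qed.

Variables (q0 q1 : probability T R) (Linf : probability dataseq R)
  (Lam : nat -> probability dataseq R).
Hypotheses (LinfE : product_law Linf (fun=> q0))
  (LamE : forall j, product_law (Lam j) (fun i => if (i < j)%N then q0 else q1 : set T -> \bar R))
  (q0G : q0 (~` finite_ratio) = 0)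
  (ratioE : density_ratio q0 q1 ratio finite_ratio).

Local Notation pend n x := (pending R (srt x) n).

Let pend_eq0 (x : dataseq) n i : (i < n)%N -> ~ finite_ratio (x i) -> pend n x = 0%R.
Proof.
move=> ni nG; rewrite /pending; case: asboolP => // /sr_time_pending/(_ i ni)[].
by move=> /nG.
Qed.

Let pendS (x : dataseq) n : pend n.+1 x = (pend n x *
  if `[< finite_ratio (x n) >] && (sr ratio 0 n.+1 x < A) then 1 else 0)%R.
Proof.
rewrite /pending; case: asboolP => xn; case: asboolP => xn1.
- by rewrite mul0r.
- rewrite mul1r; case: asboolP => xG /=; last by [].
  case: ifP => // xA; exfalso; move: xn; apply/sr_time_pending => i.
  rewrite ltnS leq_eqVlt => /predU1P[->//|]; move: i; exact/sr_time_pending.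
- by exfalso; apply: xn; apply/sr_time_leS; left.
- move/sr_time_pending: xn => /(_ n (ltnSn n))[xG ->].
  by rewrite mul1r; case: asboolP.
Qed.

(** The observations that have an infinite likelihood ratio have probability 0
    before the change, so up to the alarm the statistic is the killed chain
    started at 0. *)
Lemma sr_killed_mean n (g : R -> \bar R) : measurable_fun setT g -> (forall r, 0 <= g r) ->
  \int[Linf]_x ((pend n x)%:E * g (sr ratio 0 n x)) = iter n (kill q0 ratio A) g 0%R.
Proof.
elim: n g => [|n IH] g mg g0.
  under eq_integral do rewrite (pending0 _ sr_rule) mul1e sr_start.
  exact: integral_cst_prob.
rewrite iterSr -IH; last 2 first.
- exact: (measurable_kill q0 A measurable_ratio mg g0).
- by move=> r; exact: kill_ge0.
pose h (r : R) (t : T) : \bar R :=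
  if (sr_step ratio r t < A)%R then g (sr_step ratio r t) else 0.
pose H (z : dataseq * T) := (pend n z.1)%:E *
  ((\1_finite_ratio z.2)%:E * h (sr ratio 0 n z.1) z.2).
have mstep : measurable_fun setT (fun z : R * T => sr_step ratio z.1 z.2).
  apply: measurable_funM.
    by apply: measurable_funD; [exact: measurable_cst|exact: measurable_fst].
  exact: measurableT_comp measurable_ratio (@measurable_snd _ _ R T).
have mh : measurable_fun setT (fun z : R * T => h z.1 z.2).
  apply: measurable_fun_ifT => //; first exact: measurable_fun_ltr.
  exact: measurableT_comp mg mstep.
have h0 r t : 0 <= h r t by rewrite /h; case: ifP.
have mpE : measurable_fun setT (fun x : dataseq => (pend n x)%:E).
  by apply/measurable_EFinP; exact: (@measurable_pending _ T R _ sr_rule n).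
have mG : measurable_fun setT (fun t => (\1_finite_ratio t)%:E : \bar R).
  by apply/measurable_EFinP; apply: measurable_indic; exact: measurable_finite_ratio.
have mH : measurable_fun setT H.
  apply: emeasurable_funM; first exact: measurableT_comp mpE (@measurable_fst _ _ dataseq T).
  apply: emeasurable_funM; first exact: measurableT_comp mG (@measurable_snd _ _ dataseq T).
  have mpair : measurable_fun setT (fun z : dataseq * T => (sr ratio 0 n z.1, z.2)).
    apply: measurable_fun_pair; last exact: (@measurable_snd _ _ dataseq T).
    exact: (measurableT_comp (measurable_sr measurable_ratio 0 n) (@measurable_fst _ _ dataseq T)).
  exact: measurableT_comp mh mpair.
have H0 z : 0 <= H z by rewrite !mule_ge0 ?lee_fin ?pending_ge0.
transitivity (\int[Linf]_x H (x, x n)).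
  apply: eq_integral => x _; rewrite /H /= pendS EFinM -muleA; congr (_ * _).
  rewrite srS// /h indicE; case: asboolP => xG /=.
    by rewrite mem_set//= mul1e; case: ifP => _; rewrite ?mul1e ?mul0e.
  by rewrite memNset//= !mul0e.
rewrite (@integral_next_observation _ _ _ q0 _ LinfE n H)//; last first.
  move=> t x y xy; rewrite /H /= (@sr_determined _ _ _ ratio 0 n x y xy).
  by rewrite (@pending_determined _ _ R _ sr_rule n x y xy).
apply: eq_integral => x _; rewrite /H /=.
have mhx : measurable_fun setT (h (sr ratio 0 n x)).
  exact: (measurableT_comp mh (pair1_measurable (sr ratio 0 n x))).
rewrite ge0_integralZl//; last 3 first.
- exact: emeasurable_funM.
- by move=> t _; rewrite mule_ge0.
- by rewrite lee_fin pending_ge0.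
congr (_ * _); rewrite /kill.
apply: ge0_ae_eq_integral => //.
- exact: emeasurable_funM.
- by move=> t _; rewrite mule_ge0.
- by move=> t _; exact: h0.
exists (~` finite_ratio); split => //.
  by apply: measurableC; exact: measurable_finite_ratio.
move=> t /=; apply: contra_not => tG _.
by rewrite indicE mem_set// mul1e.
Qed.

Lemma sr_tail_prob n : (tail_prob Linf srt n)%:E = run_tail q0 ratio A n 0%R.
Proof.
rewrite -(tail_probE Linf sr_rule) /run_tail -sr_killed_mean//.
by apply: eq_integral => x _; rewrite mule1.
Qed.

Lemma sr_area_run_mean n : sr_area Linf ratio srt 0 n = run_mean q0 ratio A n 0%R.
Proof.
rewrite /run_mean -sr_killed_mean//; last first.
  by apply/measurable_EFinP; exact: normr_measurable.
by apply: eq_integral => x _; rewrite EFinM ger0_norm// sr_ge0// => t; exact: ratio_ge0.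
Qed.

Lemma sr_mean_run_length :
  \int[Linf]_x etime R (srt x) = run_length q0 ratio A 0%R.
Proof.
by rewrite (mean_tail Linf sr_rule); apply: eq_eseriesr => n _; exact: sr_tail_prob.
Qed.

(** For this rule the change of measure loses nothing, because the rule no
    longer runs once a likelihood ratio is infinite. *)
Lemma sr_total_delay :
  \sum_(k <oo) one_cycle_delay Lam srt k = run_area q0 ratio A 0%R.
Proof.
have i0 k n : 0 <= \int[Lam k]_x (if (k < n)%N then pend n x else 0)%:E.
  by apply: integral_ge0 => x _; rewrite lee_fin; case: ifP => // _; exact: pending_ge0.
rewrite (eq_eseriesr (fun k _ => one_cycle_delayE Lam sr_rule k)).
rewrite nneseries_interchange//; apply: eq_eseriesr => n _.
rewrite -sr_area_run_mean.
have [_ ->] := sr_area_change LinfE LamE measurable_ratio ratio_ge0 ratioE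
  sr_rule (leq0n n); last by move=> x i; exact: pend_eq0.
rewrite (nneseries_split 0%N n)//= add0n eseries0 ?adde0; last first.
  by move=> k nk _; rewrite ltnNge nk /= integral0.
rewrite big_nat_cond [RHS]big_nat_cond; apply: eq_bigr => k /andP[/andP[_ kn] _].
by rewrite kn.
Qed.

End ShiryaevRoberts.

(** * The alarms of the Shiryaev-Roberts rule are aperiodic *)

Section Aperiodicity.
Context (d : measure_display) (T : measurableType d) (R : realType).
Notation dataseq := (dataseq T).
Local Open Scope ereal_scope.
Variables (q0 : probability T R) (Linf : probability dataseq R).
Hypothesis LinfE : product_law Linf (fun=> q0).

Lemma integral_Linf_shift i (H : dataseq -> \bar R) : measurable_fun setT H ->
  (forall x, 0 <= H x) -> \int[Linf]_x H (shift_data i x) = \int[Linf]_x H x.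
Proof.
move=> mH H0; rewrite (integral_Linf_glue LinfE i)//; last first.
  exact: measurableT_comp mH (measurable_shift i).
under eq_integral => x _ do under eq_integral => y _ do rewrite glue_suffix.
exact: integral_cst_prob.
Qed.

Section InitialEvent.
Variables (m : nat) (e : dataseq -> bool).
Hypotheses (me : measurable_fun setT e) (de : prefix_determined m e).

Let b (f : bool) : \bar R := (f%:R)%:E.
Let b_ge0 f : 0 <= b f. Proof. by rewrite lee_fin. Qed.

Let mb (f : dataseq -> bool) : measurable_fun setT f -> measurable_fun setT (fun x => b (f x)).
Proof.
move=> mf; rewrite (_ : (fun x => _) = fun x => if f x then 1 else 0).
  by apply: measurable_fun_ifT.
by apply/funext => x; rewrite /b; case: (f x).
Qed.

(** If e almost surely implies its own shift, then by stationarity it implies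
    its shift by m, which is independent of e. *)
Lemma zero_one_of_shift_invariant :
  \int[Linf]_x b (e x && ~~ e (shift_data 1 x)) = 0 ->
  \int[Linf]_x b (e x) * \int[Linf]_x b (~~ e x) = 0.
Proof.
move=> I0.
have mne : measurable_fun setT (fun x => ~~ e x) by exact: measurable_neg.
have msh i : measurable_fun setT (fun x : dataseq => e (shift_data i x)).
  exact: measurableT_comp me (measurable_shift i).
have mstep i : measurable_fun setT
    (fun x : dataseq => e (shift_data i x) && ~~ e (shift_data i.+1 x)).
  by apply: measurable_and => //; exact: measurable_neg.
have step i : \int[Linf]_x b (e (shift_data i x) && ~~ e (shift_data i.+1 x)) = 0.
  rewrite -[RHS]I0.
  rewrite -(integral_Linf_shift i (H := fun x => b (e x && ~~ e (shift_data 1 x))))//.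
    by apply: eq_integral => x _; rewrite -shift_dataD addn1.
  exact: (mb (mstep 0%N)).
have mk k : measurable_fun setT (fun x : dataseq => e x && ~~ e (shift_data k x)).
  by apply: measurable_and => //; exact: measurable_neg.
have chain k : \int[Linf]_x b (e x && ~~ e (shift_data k x)) = 0.
  elim: k => [|k IH].
    by under eq_integral do rewrite andbN; rewrite integral0.
  apply/eqP; rewrite eq_le integral_ge0// andbT -(adde0 0).
  rewrite -{2}IH -(step k) -ge0_integralD//; try exact: mb.
  apply: ge0_le_integral => //; first exact: mb.
    by apply: emeasurable_funD; exact: mb.
  move=> x _; rewrite -EFinD lee_fin.
  by case: (e x); case: (e (shift_data k x)); case: (e (shift_data k.+1 x)) => /=; lra.
have := chain m; rewrite (integral_Linf_glue LinfE m)//; last exact: mb.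
move=> <-; rewrite -ge0_integralZr//; last 2 first.
- exact: mb.
- exact: integral_ge0.
apply: eq_integral => x _; rewrite -ge0_integralZl//; last exact: mb.
apply: eq_integral => y _; rewrite (glue_determined _ _ de) glue_suffix /b -EFinM.
by case: (e x); rewrite ?mul1r ?mul0r.
Qed.

End InitialEvent.

Variables (f0 f1 : T -> R) (A : R).
Hypotheses (mf0 : measurable_fun setT f0) (mf1 : measurable_fun setT f1)
  (f0_ge0 : forall t, (0 <= f0 t)%R) (f1_ge0 : forall t, (0 <= f1 t)%R).
Local Notation srt := (sr_time f0 f1 A).
Local Notation ratio := (ratio f0 f1).
Let ruleS := @sr_rule _ T R _ _ mf0 mf1 f0_ge0 f1_ge0 A.

Lemma sr_shift_le (x : dataseq) n : (sr ratio 0 n (shift_data 1 x) <= sr ratio 0 n.+1 x)%R.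
Proof.
elim: n => [|n IH].
  by rewrite sr_start; apply: sr_ge0 => t; exact: ratio_ge0.
rewrite !srS//; rewrite /sr_step /shift_data add1n ler_wpM2r ?ratio_ge0// lerD2l.
by move: IH; rewrite srS.
Qed.

Lemma sr_time_shift (x : dataseq) n : ~ time_le (srt x) n.+1 ->
  ~ time_le (srt (shift_data 1 x)) n.
Proof.
move=> /(sr_time_pending f0_ge0 f1_ge0) H; apply/(sr_time_pending f0_ge0 f1_ge0) => i ni.
have [xG xA] := H i.+1 ni; split; first by rewrite /shift_data add1n.
exact: le_lt_trans (sr_shift_le x i.+1) xA.
Qed.

Local Notation p := (tail_prob Linf srt).

(** Still running at m.+1 forces the rule to be still running at m both on the
    data and on the data shifted by one. If no alarm can occur at m.+1, the
    event of still running at m thus implies its own shift and has probability 0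
    or 1. *)
Lemma sr_tail_prob_decreasing m : (0 < p m < 1)%R -> (p m.+1 < p m)%R.
Proof.
move=> /andP[p0 p1]; rewrite lt_neqAle (tail_prob_noninc Linf ruleS) andbT.
apply/negP => /eqP pE.
pose e (x : dataseq) := ~~ `[< time_le (srt x) m >].
have pendE x : pending R (srt x) m = (e x)%:R by rewrite /pending /e; case: ifP.
have [mS dS _] := ruleS.
have me : measurable_fun setT e.
  apply: measurable_neg; apply: (measurable_fun_bool true).
  rewrite setTI (_ : _ @^-1` _ = [set x : dataseq | time_le (srt x) m])//.
  by apply/seteqP; split => x /= /asboolP.
have de : prefix_determined m e by move=> x y xy; rewrite /e (dS m x y xy).
have mb (f : dataseq -> bool) : measurable_fun setT f ->
    measurable_fun setT (fun x => (f x)%:R%:E : \bar R).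
  move=> mf; rewrite (_ : (fun x => _) = fun x => if f x then 1 else 0).
    by apply: measurable_fun_ifT.
  by apply/funext => x; case: (f x).
have Ie : \int[Linf]_x (e x)%:R%:E = (p m)%:E.
  by rewrite -(tail_probE Linf ruleS); apply: eq_integral => x _; rewrite pendE.
have mesh : measurable_fun setT (fun x : dataseq => e (shift_data 1 x)).
  exact: measurableT_comp me (measurable_shift 1).
have I0 : \int[Linf]_x (e x && ~~ e (shift_data 1 x))%:R%:E = 0.
  have : \int[Linf]_x (e x && ~~ e (shift_data 1 x))%:R%:E +
      \int[Linf]_x (e x && e (shift_data 1 x))%:R%:E = (p m)%:E.
    rewrite -Ie -ge0_integralD//.
    - apply: eq_integral => x _; rewrite -EFinD; congr (_%:E).
      by case: (e x); case: (e (shift_data 1 x)) => /=; rewrite ?addr0 ?add0r.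
    - by apply: mb; apply: measurable_and => //; exact: measurable_neg.
    - by apply: mb; apply: measurable_and.
  have : (p m)%:E <= \int[Linf]_x (e x && e (shift_data 1 x))%:R%:E.
    rewrite -pE -(tail_probE Linf ruleS); apply: ge0_le_integral => //.
    - by move=> x _; rewrite lee_fin pending_ge0.
    - by apply/measurable_EFinP; exact: (@measurable_pending _ T R _ ruleS).
    - by apply: mb; apply: measurable_and.
    - move=> x _; rewrite lee_fin {1}/pending; case: asboolP => // H.
      have xm : e x.
        by apply/asboolPn => h; apply: H; apply/sr_time_leS; left.
      by rewrite xm /=; have -> : e (shift_data 1 x) by apply/asboolPn; exact: sr_time_shift.
  have : 0 <= \int[Linf]_x (e x && ~~ e (shift_data 1 x))%:R%:E by exact: integral_ge0.
  set I := \int[Linf]_x _; set J := \int[Linf]_x _.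
  case: I => [i| |] // i0; case: J => [j| |]// ; rewrite !lee_fin => pj -[ij].
  by congr (_%:E); move: i0; rewrite lee_fin => i0; lra.
have := zero_one_of_shift_invariant me de I0.
have -> : \int[Linf]_x (~~ e x)%:R%:E = (1 - p m)%:E.
  have : \int[Linf]_x (e x)%:R%:E + \int[Linf]_x (~~ e x)%:R%:E = 1.
    rewrite -ge0_integralD//; last 2 first.
    - exact: mb.
    - by apply: mb; exact: measurable_neg.
    rewrite -[RHS](integral_cst_prob Linf); apply: eq_integral => x _.
    by rewrite -EFinD; congr (_%:E); case: (e x) => /=; rewrite ?addr0 ?add0r.
  rewrite Ie; set J := \int[Linf]_x _; case: J => [j| |]// [<-].
  by congr (_%:E); lra.
rewrite Ie -EFinM => -[/eqP]; rewrite mulf_eq0 => /orP[/eqP|/eqP]; lra.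
Qed.

End Aperiodicity.

(** * Limits of the delay *)

Section Asymptotics.
Context (d : measure_display) (T : measurableType d) (R : realType).
Notation dataseq := (dataseq T).
Local Open Scope ereal_scope.
Variables (q0 q1 : probability T R) (Linf : probability dataseq R)
  (Lam : nat -> probability dataseq R).
Hypotheses (LinfE : product_law Linf (fun=> q0))
  (LamE : forall j, product_law (Lam j) (fun i => if (i < j)%N then q0 else q1 : set T -> \bar R)).

Section Rule.
Variable N : dataseq -> option nat.
Hypothesis ruleN : detection_rule N.
Local Notation p := (tail_prob Linf N).
Local Notation D := (one_cycle_delay Lam N).

Let p0 := tail_prob0 Linf ruleN.
Let p_ge0 := tail_prob_ge0 Linf N.
Let p_noninc := tail_prob_noninc Linf ruleN.
Let D_ge0 := one_cycle_delay_ge0 Lam N.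

Lemma sum_tail_cvg : \sum_(k < n) (p k)%:E @[n --> \oo] --> \sum_(k <oo) (p k)%:E.
Proof.
have := @is_cvg_nneseries R (fun k => (p k)%:E) xpredT 0%N (fun n _ _ => p_ge0 n).
by under eq_fun do rewrite big_mkord.
Qed.

Lemma sum_tail_cvg_real (mu : R) : \sum_(k <oo) (p k)%:E = mu%:E ->
  (fun n => \sum_(k < n) p k)%R @ \oo --> mu.
Proof.
move=> pmu; have := sum_tail_cvg; rewrite pmu => /fine_cvgP[_].
by apply: cvg_trans; apply: near_eq_cvg; near=> n; rewrite /= sumEFin.
Unshelve. all: by end_near. Qed.

Lemma tail_prob_cvg0 (mu : R) : \sum_(k <oo) (p k)%:E = mu%:E -> p @ \oo --> 0%R.
Proof.
move=> /sum_tail_cvg_real pmu; apply: cvg_series_cvg_0.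
rewrite /series /=; under eq_fun do rewrite big_mkord.
exact: cvgP pmu.
Qed.

(** The solution of the renewal equation is a convolution with the renewal
    probabilities, which converge to 1 / mu. *)
Lemma delay_cvg (mu : R) : \sum_(k <oo) (p k)%:E = mu%:E ->
  (forall k, (forall n, (p n.+1 < p n)%R -> (k %| n.+1)%N) -> k = 1%N) ->
  delay Lam N @ \oo --> (mu^-1)%:E * \sum_(k <oo) D k.
Proof.
move=> pmu aper; have [u [u0 uS]] := renewal_sequence_exists p.
have mu0 : (0 < mu)%R.
  have := @nneseries_lim_ge R (fun k => (p k)%:E) xpredT 0%N 1%N (fun n _ _ => p_ge0 n).
  by rewrite big_nat1 p0 pmu lee_fin; exact: lt_le_trans.
rewrite (_ : delay Lam N = fun t => \sum_(s < t.+1) (u s)%:E * D (t - s)%N); last first.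
  apply/funext => t; apply: (renewal_equation_solution p_noninc u0 uS D_ge0) => {}t.
  exact: (renewal_equation LinfE LamE ruleN).
apply: cvg_convolution => //; first by rewrite invr_gt0.
  move=> n; rewrite (renewal_ge0 p_noninc u0 uS).
  exact: (renewal_le1 p0 p_ge0 p_noninc u0 uS).
apply: (renewal_theorem p0 p_ge0 p_noninc u0 uS _ aper); last exact: sum_tail_cvg_real.
exact: tail_prob_cvg0 pmu.
Qed.

Variables (lr : T -> R) (G : set T).
Hypotheses (mlr : measurable_fun setT lr) (lr_ge0 : forall t, (0 <= lr t)%R)
  (lrE : density_ratio q0 q1 lr G).
Variables (B c : R) (w : R -> R).
Hypotheses (B_gt0 : (0 < B)%R) (c_ge0 : (0 <= c)%R) (mw : measurable_fun setT w)
  (w_ge0 : forall r, (0 <= w r)%R)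
  (wE : forall r, (0 <= r)%R ->
     c%:E + \int[q0]_t (w (sr_step lr r t))%:E <= (r + w r)%:E).
Hypothesis mean_ge : B%:E <= \sum_(k <oo) (p k)%:E.

(** The verification inequality bounds the cost of each cycle, and
    delay_limit_ge averages over cycles. *)
Lemma delay_limit_lower_bound (l : \bar R) : delay Lam N @ \oo --> l ->
  (c - w 0%R / B)%:E <= l.
Proof.
have [u [u0 uS]] := renewal_sequence_exists p.
rewrite (_ : delay Lam N = fun t => \sum_(s < t.+1) (u s)%:E * D (t - s)%N); last first.
  apply/funext => t; apply: (renewal_equation_solution p_noninc u0 uS D_ge0) => {}t.
  exact: (renewal_equation LinfE LamE ruleN).
apply: (delay_limit_ge p0 p_ge0 p_noninc u0 uS B_gt0 c_ge0 (w_ge0 0%R) D_ge0).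
  move=> a m am.
  exact: (one_cycle_delay_lower_bound LinfE LamE mlr lr_ge0 lrE ruleN c_ge0 mw w_ge0 wE am).
move=> b bB; apply: contrapT => nb.
have : \sum_(k <oo) (p k)%:E <= b%:E.
  rewrite -(cvg_lim _ sum_tail_cvg)//; apply: lime_le; first by apply: cvgP sum_tail_cvg.
  apply: nearW => n; rewrite sumEFin lee_fin leNgt; apply/negP => bn.
  by apply: nb; exists n; exact: ltW.
by move=> /(le_trans mean_ge); rewrite lee_fin leNgt bB.
Qed.

End Rule.
End Asymptotics.

(** * Change-point models *)

Section NonnegativeThreshold.
Context (d : measure_display) (T : measurableType d) (R : realType).
Variables (Q : probability T R) (lr : T -> R) (A : R).
Hypotheses (mlr : measurable_fun setT lr) (lr_ge0 : forall t, 0 <= lr t).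
Local Open Scope ereal_scope.

(** If A <= 0 every run has length 1 and area 0, so the price is 0. *)
Lemma optimal_threshold (B : R) : run_length Q lr A 0%R = B%:E ->
  exists (c : R) (w : R -> R), [/\ (0 <= c)%R, measurable_fun setT w,
  (forall r, 0 <= w r)%R,
  (forall r, (0 <= r)%R ->
     c%:E + \int[Q]_t (w (sr_step lr r t))%:E <= (r + w r)%:E) &
  run_area Q lr A 0%R + (w 0%R)%:E = (c * B)%:E].
Proof.
move=> lB; have [A_gt0|A_le0] := ltP 0%R A; first exact: optimal_threshold_pos lB.
exists 0%R, (fun=> 0%R); split => //.
- by move=> r r0; rewrite integral0 add0e addr0 lee_fin.
- rewrite mul0r adde0 /run_area eseries0// => -[|m] _ _; rewrite /run_mean /=.
    by rewrite normr0.
  apply: integral0_eq => t _; rewrite ifF//; apply/negbTE; rewrite -leNgt.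
  by apply: le_trans A_le0 _; exact: sr_step_ge0.
Qed.

End NonnegativeThreshold.

Section StoppingTimes.
Context (d : measure_display) (T : measurableType d).
Notation dataseq := (dataseq T).

(** The sets with the two properties form a sigma-algebra that contains the
    preimages under the first n coordinates. *)
Lemma g_sigma_preimage_coord n (E : set dataseq) :
  g_sigma_preimage (fun (i : 'I_n) (x : nat -> T) => x i) E ->
  measurable E /\ prefix_determined n (fun x => E x).
Proof.
move: E; rewrite /g_sigma_preimage.
set S := \big[setU/set0]_(i < n) _.
pose good := [set E : set dataseq | measurable E /\ prefix_determined n (fun x => E x)].
suff H : <<s S >> `<=` good by move=> E /H.
apply: smallest_sub; first split.
- by split; [exact: measurable0|move=> x y].
- move=> E [mE dE]; split; first exact: measurableD.
  by move=> x y xy; rewrite /setD /= (dE x y xy).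
- move=> F FG; split; first by apply: bigcupT_measurable => k; have [] := FG k.
  move=> x y xy; rewrite propeqE; split => -[k _ Fk]; exists k => //.
    by have [_ dF] := FG k; rewrite -(dF x y xy).
  by have [_ dF] := FG k; rewrite (dF x y xy).
- rewrite /S => E; elim/big_ind: _ => [//|S1 S2 H1 H2 [/H1|/H2]//|i _].
  move=> [C mC <-]; rewrite setTI; split.
    rewrite -[X in measurable X]setTI; exact: (measurable_coord i measurableT mC).
  by move=> x y xy; rewrite /= xy.
Qed.

Lemma stopping_time_rule (N : dataseq -> option nat) : stopping_time N ->
  (forall x, ~ time_le (N x) 0) -> detection_rule N.
Proof.
by move=> sN N0; split=> // n; have [] := g_sigma_preimage_coord (sN n).
Qed.

Lemma stopping_time_zero (N : dataseq -> option nat) (x0 : dataseq) : stopping_time N ->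
  time_le (N x0) 0 -> forall x, N x = Some 0%N.
Proof.
move=> sN N0 x; have [_ dN] := g_sigma_preimage_coord (sN 0%N).
have : time_le (N x) 0 by have /= -> := dN x x0 (fun i => ltac:(by [])).
by case: (N x) => //= -[].
Qed.

End StoppingTimes.

Section Model.
Context (R : realType) (d dO : measure_display) (T : measurableType d)
  (Omega : measurableType dO).
Notation dataseq := (dataseq T).
Local Open Scope ereal_scope.
Variables (X : nat -> Omega -> T).
Hypothesis mX : forall i, measurable_fun setT (X i).

Definition observe (w : Omega) : dataseq := fun i => X i w.

Lemma measurable_observe : measurable_fun setT observe.
Proof. by apply: measurable_to_dataseq => i; exact: mX. Qed.

Let observe_mixin := isMeasurableFun.Build _ _ _ _ _ measurable_observe.
Let observe_mfun : {mfun Omega >-> dataseq} := HB.pack observe observe_mixin.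

Let X_mixin i := isMeasurableFun.Build _ _ _ _ _ (mX i).
Let X_mfun i : {mfun Omega >-> T} := HB.pack (X i) (X_mixin i).

Definition data_law (P : probability Omega R) : probability dataseq R :=
  distribution P observe_mfun.
Definition coord_law (P : probability Omega R) i : probability T R :=
  distribution P (X_mfun i).

Lemma integral_data_law (P : probability Omega R) (H : dataseq -> \bar R) : measurable_fun setT H ->
  (forall x, 0 <= H x) -> \int[P]_w H (X ^~ w) = \int[data_law P]_x H x.
Proof.
by move=> mH H0; rewrite /data_law ge0_integral_pushforward//.
Qed.

Lemma data_law_product (P : probability Omega R) (mu : {measure set T -> \bar R}) g
    (q : nat -> set T -> \bar R) :
  independent_with_densities P X mu g ->
  (forall i A, measurable A -> q i A = \int[mu]_(x in A) (g i x)%:E) ->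
  product_law (data_law P) q.
Proof.
move=> [ind den] qE n A mA.
transitivity (P (\big[setI/setT]_(i <- iota 0 n) (X i @^-1` A i))).
  transitivity (P (observe @^-1` box n A)); first by [].
  congr (P _); rewrite -bigcap_seq; apply/seteqP; split => w /= H i /=.
    by rewrite mem_iota add0n => /H.
  by move=> ni; apply: (H i); rewrite /= mem_iota add0n.
rewrite ind ?iota_uniq//.
rewrite -{1}(subn0 n) -/(index_iota 0 n) big_mkord; apply: eq_bigr => i _.
by rewrite den// qE.
Qed.


Variables (mu : {measure set T -> \bar R}) (f0 f1 : T -> R)
  (Pinf : probability Omega R) (P : nat -> probability Omega R).
Hypothesis model : changepoint_model mu f0 f1 X Pinf P.

Let q0 := coord_law Pinf 0.
Let q1 := coord_law (P 1%N) 0.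
Let Linf := data_law Pinf.
Let Lam j := data_law (P j.+1).

Let q0E A : measurable A -> q0 A = \int[mu]_(x in A) (f0 x)%:E.
Proof. by have [_ _ _ [_ den] _] := model => mA; rewrite -(den 0%N). Qed.

Let q1E A : measurable A -> q1 A = \int[mu]_(x in A) (f1 x)%:E.
Proof.
by have [_ _ _ _ /(_ 1%N isT)[_ den]] := model => mA; rewrite -(den 0%N A mA).
Qed.

Lemma no_change_law : product_law Linf (fun=> q0).
Proof.
have [_ _ _ indep _] := model.
by apply: (data_law_product indep) => _ A mA; rewrite q0E.
Qed.

Lemma change_law j : product_law (Lam j)
  (fun i => if (i < j)%N then q0 else q1 : set T -> \bar R).
Proof.
have [_ _ _ _ /(_ j.+1 isT) indep] := model.
apply: (data_law_product indep) => i A mA; rewrite /change_density ltnS.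
by case: ltnP => _; [rewrite q0E|rewrite q1E].
Qed.

Let mf0 : measurable_fun setT f0. Proof. by have [[]] := model. Qed.
Let mf1 : measurable_fun setT f1. Proof. by have [_ []] := model. Qed.
Let f0_ge0 t : (0 <= f0 t)%R. Proof. by have [[]] := model. Qed.
Let f1_ge0 t : (0 <= f1 t)%R. Proof. by have [_ []] := model. Qed.

Let mG := measurable_finite_ratio mf0 mf1.

Lemma infinite_ratio_null : q0 (~` finite_ratio f0 f1) = 0.
Proof.
rewrite q0E; last exact: measurableC.
apply: integral0_eq => t /= /negP; rewrite negb_or negbK => /andP[/eqP -> _].
by [].
Qed.

(** ratio * f0 = f1 wherever the likelihood ratio is finite, and elsewhere f0
    vanishes. *)
Lemma integral_ratio : density_ratio q0 q1 (ratio f0 f1) (finite_ratio f0 f1).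
Proof.
move=> g mg g0.
have mr : measurable_fun setT (fun t => (ratio f0 f1 t)%:E).
  by apply/measurable_EFinP; exact: measurable_ratio.
have r0 t : 0 <= (ratio f0 f1 t)%:E by rewrite lee_fin ratio_ge0.
have mgr : measurable_fun setT (fun t => g t * (ratio f0 f1 t)%:E).
  exact: emeasurable_funM.
rewrite (integral_density mf0 f0_ge0 q0E mgr); last by move=> t; rewrite mule_ge0.
rewrite (integral_density mf1 f1_ge0 q1E mg)//.
have E t : finite_ratio f0 f1 t -> g t * (ratio f0 f1 t)%:E * (f0 t)%:E = g t * (f1 t)%:E.
  rewrite -muleA -EFinM /finite_ratio /ratio /=.
  by case: eqP => [-> /= /eqP ->|/eqP f00 _]; rewrite ?mulr0// divfK.
split.
  apply: ge0_le_integral => //.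
  - by move=> t _; apply: mule_ge0; [exact: mule_ge0|rewrite lee_fin].
  - by apply: emeasurable_funM => //; exact/measurable_EFinP.
  - by apply: emeasurable_funM => //; exact/measurable_EFinP.
  - move=> t _; have [/E ->//|] := pselect (finite_ratio f0 f1 t).
    move=> /negP; rewrite negb_or negbK => /andP[/eqP -> _].
    by rewrite mule0 mule_ge0 ?lee_fin.
move=> gG; apply: eq_integral => t _; have [/E //|/gG ->] := pselect (finite_ratio f0 f1 t).
by rewrite !mul0e.
Qed.

Lemma mean_timeE (N : dataseq -> option nat) : detection_rule N ->
  mean_time Pinf X N = \sum_(n <oo) (tail_prob Linf N n)%:E.
Proof.
move=> ruleN; rewrite -(mean_tail Linf ruleN) /mean_time.
have mN : measurable_fun setT (fun x => etime R (N x)).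
  rewrite (_ : (fun x => _) = fun x => late R (N x) 0); first exact: measurable_late.
  by apply/funext => x; rewrite late0.
rewrite -integral_data_law// => x; rewrite -late0; exact: late_ge0.
Qed.

Lemma mean_delayE (N : dataseq -> option nat) t : detection_rule N ->
  mean_delay P X N t.+1 = delay Lam N t.
Proof.
move=> ruleN; rewrite /delay -integral_data_law.
- apply: eq_integral => w _; rewrite /first_alarm_delay -late_etime//.
  exact: first_alarm_from_ge.
- exact: measurable_first_alarm_delay.
- by move=> x; exact: late_ge0.
Qed.

Lemma mean_delay_cvg (N : dataseq -> option nat) (l : \bar R) : detection_rule N ->
  (mean_delay P X N @ \oo --> l) <-> (delay Lam N @ \oo --> l).
Proof.
move=> ruleN; rewrite -cvg_shiftS.
by rewrite (_ : (fun n => _) = delay Lam N)//; apply/funext => t; exact: mean_delayE.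
Qed.

Lemma measurable_stop_event (N : dataseq -> option nat) s : detection_rule N ->
  measurable [set x : dataseq | N x = Some s.+1].
Proof.
move=> ruleN; rewrite (_ : [set x | _] =
    (fun x : dataseq => (if N x == Some s.+1 then 1 else 0)%R : R) @^-1` [set 1%R]).
  by rewrite -[X in measurable X]setTI; exact: (@measurable_stop _ T R N ruleN s).
by apply/seteqP; split => x /=; case: eqP => // _ /esym/eqP; rewrite oner_eq0.
Qed.

Lemma stop_law (N : dataseq -> option nat) s : detection_rule N ->
  Pinf [set w | N (X ^~ w) = Some s.+1] =
    (tail_prob Linf N s - tail_prob Linf N s.+1)%:E.
Proof.
move=> ruleN; rewrite -(integral_stop Linf ruleN).
have mE := measurable_stop_event s ruleN.
transitivity (Linf [set x : dataseq | N x = Some s.+1]); first by [].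
rewrite -[LHS]mul1e -integral_cst// integral_mkcond.
apply: eq_integral => x _; rewrite patchE; case: eqP => [Nx|Nx].
  by rewrite mem_set.
by rewrite memNset.
Qed.

Lemma aperiodic_tail (N : dataseq -> option nat) : detection_rule N ->
  aperiodic Pinf X N ->
  forall k, (forall n, (tail_prob Linf N n.+1 < tail_prob Linf N n)%R -> (k %| n.+1)%N) ->
    k = 1%N.
Proof.
move=> ruleN aper k Hk; apply: aper => -[//|s].
by rewrite stop_law// lte_fin subr_gt0 => /Hk.
Qed.

(** The decision to stop at time 0 does not depend on the data, so it would make
    the mean vanish. *)
Lemma mean_pos_rule (N : dataseq -> option nat) : stopping_time N ->
  0 < mean_time Pinf X N -> detection_rule N.
Proof.
move=> sN N_gt0; apply: stopping_time_rule => // x0 N0; move: N_gt0.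
rewrite /mean_time; under eq_integral do rewrite (stopping_time_zero sN N0).
by rewrite integral0 ltxx.
Qed.

Variables (A B : R).
Hypotheses (B_gt0 : (0 < B)%R)
  (mean_A : mean_time Pinf X (sr_time f0 f1 A) = B%:E)
  (nondeg : forall m : nat, (1 < m)%N ->
     ~ {ae Pinf, forall w, sr_time f0 f1 A (X ^~ w) = Some m}).
Local Notation srt := (sr_time f0 f1 A).

Let ruleS : detection_rule srt := sr_rule mf0 mf1 f0_ge0 f1_ge0 A.
Let mean_S : \sum_(n <oo) (tail_prob Linf srt n)%:E = B%:E.
Proof. by rewrite -mean_timeE. Qed.

(** Let m be the first time at which an alarm can occur. Unless m = 1, an alarm
    at m is not almost sure, and then an alarm at m.+1 is possible as well; m
    and m.+1 are coprime. *)
Lemma sr_aperiodic k :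
  (forall n, (tail_prob Linf srt n.+1 < tail_prob Linf srt n)%R -> (k %| n.+1)%N) ->
  k = 1%N.
Proof.
move=> Hk; set p := tail_prob Linf srt in Hk.
have p0 : p 0%N = 1%R by exact: tail_prob0.
have [n pn1] : exists n, (p n < 1)%R.
  have /cvgrPdist_lt/(_ _ ltr01)[n _ /(_ n (leqnn _))] := tail_prob_cvg0 mean_S.
  by rewrite sub0r normrN => pn; exists n; exact: le_lt_trans (ler_norm _) pn.
have ex : exists n, (p n < 1)%R by exists n.
have {n pn1} := ex_minnP ex; case=> -[|s] pn pmin; first by rewrite p0 ltxx in pn.
have ps : p s = 1%R.
  apply/eqP; rewrite eq_le; apply/andP; split.
    by rewrite -p0; apply: tail_noninc => //; exact: tail_prob_noninc.
  by rewrite leNgt; apply/negP => ps1; have := pmin s ps1; rewrite ltnn.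
have ks : (k %| s.+1)%N by apply: Hk; rewrite ps.
case: s => [|s] in pn pmin ps ks *; first by move: ks; rewrite dvdn1 => /eqP.
have p_gt0 : (0 < p s.+2)%R.
  rewrite lt_neqAle tail_prob_ge0 andbT eq_sym; apply/negP => /eqP ps0.
  (* As p s.+1 = 1 and p s.+2 = 0, the alarm time is almost surely s.+2. *)
  apply: (@nondeg s.+2 isT).
  have E := stop_law s.+1 ruleS; rewrite -/p ps ps0 subr0 in E.
  have mE : measurable [set w | srt (X ^~ w) = Some s.+2].
    have := measurable_observe measurableT (measurable_stop_event s.+1 ruleS).
    by rewrite setTI.
  exists (~` [set w | srt (X ^~ w) = Some s.+2]); split => //.
    exact: measurableC.
  by rewrite probability_setC// E subee.
have : (p s.+3 < p s.+2)%R.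
  by apply: (sr_tail_prob_decreasing no_change_law) => //; rewrite p_gt0.
move=> /Hk ks'.
by apply/eqP; rewrite -dvdn1 -(dvdn_addr _ ks) addn1.
Qed.


Let ratio_ge t : (0 <= ratio f0 f1 t)%R. Proof. exact: ratio_ge0. Qed.
Let mratio := measurable_ratio mf0 mf1 f0_ge0.
(** The limit is the expected area of a run divided by its expected length B,
    and the area is c * B - w 0 by optimal_threshold. *)
Lemma sr_mean_delay_cvg : exists (c : R) (w : R -> R), [/\ (0 <= c)%R,
  measurable_fun setT w, (forall r, 0 <= w r)%R,
  (forall r, (0 <= r)%R ->
     c%:E + \int[q0]_t (w (sr_step (ratio f0 f1) r t))%:E <= (r + w r)%:E) &
  mean_delay P X srt @ \oo --> (c - w 0%R / B)%:E].
Proof.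
have lB : run_length q0 (ratio f0 f1) A 0%R = B%:E.
  rewrite -mean_S -(mean_tail Linf ruleS); apply: esym.
  exact: (sr_mean_run_length mf0 mf1 f0_ge0 f1_ge0 A no_change_law infinite_ratio_null).
have [c [w [c0 mw w0 wE area]]] := optimal_threshold mratio ratio_ge lB.
exists c, w; split=> //; apply/(mean_delay_cvg _ ruleS).
have E : run_area q0 (ratio f0 f1) A 0%R = (c * B - w 0%R)%:E.
  move: area; case: run_area => [a| |]// [<-].
  by rewrite addrK.
have -> : (c - w 0%R / B)%:E = (B^-1)%:E * \sum_(k <oo) one_cycle_delay Lam srt k.
  rewrite (sr_total_delay mf0 mf1 f0_ge0 f1_ge0 A no_change_law change_law infinite_ratio_null
    integral_ratio) E -EFinM; congr (_%:E).
  by rewrite mulrBr mulrCA mulVf ?gt_eqF// mulr1 mulrC.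
exact: (delay_cvg no_change_law change_law ruleS mean_S sr_aperiodic).
Qed.

Lemma mean_delay_is_cvg (N : dataseq -> option nat) : stopping_time N ->
  B%:E <= mean_time Pinf X N -> mean_time Pinf X N < +oo -> aperiodic Pinf X N ->
  cvgn (mean_delay P X N).
Proof.
move=> sN BN Noo aper.
have N_gt0 : 0 < mean_time Pinf X N by apply: lt_le_trans BN; rewrite lte_fin.
have ruleN := mean_pos_rule sN N_gt0.
have Nfin : mean_time Pinf X N \is a fin_num by rewrite ge0_fin_numE// ltW.
have E := mean_timeE ruleN; rewrite -(fineK Nfin) in E.
apply: cvgP; apply/(mean_delay_cvg _ ruleN).
exact: (delay_cvg no_change_law change_law ruleN (esym E) (aperiodic_tail ruleN aper)).
Qed.

(** The constants c and w 0 are the same for all rules, so the limit for the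
    Shiryaev-Roberts rule is exactly the lower bound of delay_limit_lower_bound. *)
Lemma sr_mean_delay_le (N : dataseq -> option nat) : stopping_time N ->
  B%:E <= mean_time Pinf X N -> cvgn (mean_delay P X N) ->
  limn (mean_delay P X srt) <= limn (mean_delay P X N).
Proof.
move=> sN BN cN.
have N_gt0 : 0 < mean_time Pinf X N by apply: lt_le_trans BN; rewrite lte_fin.
have ruleN := mean_pos_rule sN N_gt0.
have [c [w [c0 mw w0 wE /cvg_lim ->//]]] := sr_mean_delay_cvg.
apply: (delay_limit_lower_bound no_change_law change_law ruleN mratio ratio_ge
  integral_ratio B_gt0 c0 mw w0 wE).
- by rewrite -mean_timeE.
- exact/(mean_delay_cvg _ ruleN).
Qed.

End Model.

Theorem theorem2 (R : realType) (d dO : measure_display)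
    (T : measurableType d) (Omega : measurableType dO)
    (mu : {measure set T -> \bar R}) (f0 f1 : T -> R)
    (X : nat -> Omega -> T)
    (Pinf : probability Omega R) (P : nat -> probability Omega R)
    (B A : R)
    (model : changepoint_model mu f0 f1 X Pinf P)
    (B_gt0 : 0 < B)
    (mean_A : mean_time Pinf X (sr_time f0 f1 A) = B%:E)
    (nondeg : forall m : nat, (1 < m)%N ->
       ~ {ae Pinf, forall w, sr_time f0 f1 A (X ^~ w) = Some m}) :
  [/\ exists L : R, mean_delay P X (sr_time f0 f1 A) @ \oo --> L%:E,
      forall N : (nat -> T) -> option nat,
        stopping_time N -> mean_time Pinf X N = B%:E ->
        (aperiodic Pinf X N -> cvgn (mean_delay P X N)) /\
        (cvgn (mean_delay P X N) ->
           (limn (mean_delay P X (sr_time f0 f1 A))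
              <= limn (mean_delay P X N))%E)
    & forall N : (nat -> T) -> option nat,
        stopping_time N -> (B%:E <= mean_time Pinf X N)%E ->
        ((mean_time Pinf X N < +oo)%E -> aperiodic Pinf X N ->
           cvgn (mean_delay P X N)) /\
        (cvgn (mean_delay P X N) ->
           (limn (mean_delay P X (sr_time f0 f1 A))
              <= limn (mean_delay P X N))%E)].
Proof.
have [_ _ mX _ _] := model.
split.
- have [c [w [_ _ _ _ cL]]] := sr_mean_delay_cvg mX model B_gt0 mean_A nondeg.
  by exists (c - w 0 / B).
- move=> N sN NB; have BN : (B%:E <= mean_time Pinf X N)%E by rewrite NB.
  split; last exact: (sr_mean_delay_le mX model B_gt0 mean_A nondeg sN BN).
  by apply: (mean_delay_is_cvg mX model B_gt0 sN BN); rewrite NB ltry.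
- move=> N sN BN; split; first exact: (mean_delay_is_cvg mX model B_gt0 sN BN).
  exact: (sr_mean_delay_le mX model B_gt0 mean_A nondeg sN BN).
Qed.
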